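(* Let $m\ge 1$ be an integer. (Continuous time.) Let $p>0$ and $\tau\ge 0$ be real, let $u\in L_2[0,\infty)$ be real-valued with continuous Laguerre spectrum $(u_j)_{j\ge 0}$ (with Laguerre parameter $p$) such that $u_0\neq 0$, and let $(y_j)_{j\ge 0}$ be the continuous Laguerre spectrum (same $p$) of the delayed signal $y(t)=u(t-\tau)$, $t\in[0,\infty)$. Let $(h_k)_{k\ge0}$ be the Laguerre-domain Markov parameters computed from $(u_j)$ and $(y_j)$, and put $\kappa=2p\tau$. Then $$\kappa=-\frac{(m+1)h_{m+1}+(m-1)h_{m-1}-2m\,h_m}{h_m}.$$ (Discrete time.) Let $0<p<1$, $\xi=\sqrt p$, and let $\tau\ge0$ be an integer. Let $u\in\ell^2[0,\infty)$ be a real sequence with discrete Laguerre spectrum $(u_j)_{j\ge 0}$ (with Laguerre parameter $p$) such that $u_0\ne0$, and let $(y_j)_{j\ge0}$ be the discrete Laguerre spectrum (same $p$) of the delayed signal $y(t)=u(t-\tau)$, $t=0,1,2,\dots$. Let $(h_k)_{k\ge0}$ be the Laguerre-domain Markov parameters computed from $(u_j)$ and $(y_j)$. Then $$\tau=-\frac{(m+1)h_{m+1}+(m-1)h_{m-1}+m(\xi+\xi^{-1})h_m}{(\xi-\xi^{-1})h_m}.$$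
   Context: Delayed signals: in both cases $u(t)$ is taken to be $0$ for $t<0$, so $u(t-\tau)=0$ for $t<\tau$. Continuous Laguerre spectrum: for $p>0$ and integer $k\ge 0$, the Laguerre functions are given in the Laplace domain by $\ell_k(s)=\frac{\sqrt{2p}}{s+p}\left(\frac{s-p}{s+p}\right)^k$. They form an orthonormal complete basis of the Hardy space of functions analytic in the open right half-plane (Laplace transforms of functions in $L_2[0,\infty)$) with respect to $\langle W,V\rangle=\frac{1}{2\pi i}\int_{-i\infty}^{i\infty}W(s)V(-s)\,ds$. For $w\in L_2[0,\infty)$ with Laplace transform $W$, its continuous Laguerre spectrum is $w_j=\langle W,\ell_j\rangle$, $j\ge0$. Discrete Laguerre spectrum: for $0<p<1$ and integer $j\ge0$, the discrete Laguerre functions are $L_j(z)=\frac{\sqrt{1-p}}{z-\sqrt p}\left(\frac{1-\sqrt p\,z}{z-\sqrt p}\right)^j$. They form an orthonormal complete basis of the Hardy space of functions analytic outside the closed unit disc, square-integrable on the unit circle $D$ and vanishing at infinity, with respect to $\langle W,V\rangle=\frac{1}{2\pi i}\oint_D W(z)V(z^{-1})\frac{dz}{z}$. A sequence $w\in\ell^2[0,\infty)$ is identified with the function $W(z)=\sum_{t\ge0}w(t)z^{-(t+1)}$, and its discrete Laguerre spectrum is $w_j=\langle W,L_j\rangle$, $j\ge0$. Laguerre-domain Markov parameters: given real sequences $(u_j)$ with $u_0\ne0$ and $(y_j)$, they are $$h_k=\sum_{j=0}^k g_{k-j}\,y_j,\quad k\ge0,\qquad\text{where } g_0=\frac1{u_0},\quad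 g_k=-\frac1{u_0}\sum_{j=0}^{k-1}u_{k-j}\,g_j\ \ (k\ge1).$$
   Formalization: Both formulas are stated under the added assumption h_m ≠ 0; without it the right-hand sides are undefined, for example when τ = 0 (then h_m = 0 for all m ≥ 1) or, in continuous time, when m = 2 and κ = 2. *)

(* Defs.v *)
From HB Require Import structures.
From mathcomp Require Import all_boot all_order all_algebra.
From mathcomp Require Import all_classical all_reals all_analysis.
From mathcomp.real_closed Require Import complex.

Set Implicit Arguments.
Unset Strict Implicit.
Unset Printing Implicit Defensive.

Import Order.TTheory GRing.Theory Num.Theory.
Import numFieldNormedType.Exports.

Local Open Scope classical_set_scope.
Local Open Scope ring_scope.
Local Open Scope complex_scope.

Section ComplexIntegrals.
Context {R : realType}.
Local Notation mu := (@lebesgue_measure R).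
Local Notation normc := ComplexField.Normc.normc.
Implicit Types (D : set R) (f : R -> R[i]) (F : R[i] -> R[i]).

Definition cintegral D f : R[i] :=
  (\int[mu]_(x in D) complex.Re (f x)) +i* (\int[mu]_(x in D) complex.Im (f x)).

Definition square_integrable D f : Prop :=
  [/\ measurable_fun D (fun x => complex.Re (f x)),
      measurable_fun D (fun x => complex.Im (f x)) &
      (\int[mu]_(x in D) (normc (f x) ^+ 2)%:E < +oo)%E].

Definition l2_dist2 D f g : \bar R :=
  (\int[mu]_(x in D) (normc (f x - g x) ^+ 2)%:E)%E.

Definition cexp (s : R[i]) : R[i] :=
  (expR (complex.Re s))%:C * (cos (complex.Im s) +i* sin (complex.Im s)).

(* the integral of F(s) ds for s from -i oo to i oo, with s = i omega *)
Definition vline_integral F : R[i] :=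
  cintegral setT (fun omega => F (omega *i) * 'i).

(* the integral of F(z) dz over the unit circle, with z = e^(i theta) *)
Definition circle_integral F : R[i] :=
  cintegral `[0, 2 * pi]
    (fun theta => F (cexp (theta *i)) * ('i * cexp (theta *i))).

End ComplexIntegrals.

Section ContinuousTime.
Context {R : realType}.
Implicit Types (w : R -> R) (W V : R[i] -> R[i]).

(* A real signal in L_2[0, oo), extended by 0 to negative times. *)
Definition L2_signal w : Prop :=
  (forall t, t < 0 -> w t = 0) /\ w \in Lfun (@lebesgue_measure R) 2%:E.

Definition cdelay (tau : R) w : R -> R := fun t => w (t - tau).

Definition laplace w (s : R[i]) : R[i] :=
  cintegral `[0, +oo[ (fun t => (w t)%:C * cexp (- (s * t%:C))).

(* W is the Laplace transform of w as an element of the Hardy space: analytic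
   values in the open right half-plane, and on the imaginary axis the L_2
   boundary values, i.e. the L_2 limit of W(x + i omega) as x -> 0+. For w in
   L_2[0, oo) such a W exists and is unique almost everywhere on the axis. *)
Definition is_laplace_transform w W : Prop :=
  [/\ forall s, 0 < complex.Re s -> W s = laplace w s,
      square_integrable setT (fun omega => W (omega *i)) &
      l2_dist2 setT (fun omega => W (x +i* omega)) (fun omega => W (omega *i))
        @[x --> (0 : R)^'+] --> 0%E].

Definition claguerre (p : R) (k : nat) (s : R[i]) : R[i] :=
  (Num.sqrt (2 * p))%:C / (s + p%:C) * ((s - p%:C) / (s + p%:C)) ^+ k.

Definition cinner W V : R[i] :=
  (2 * pi%:C * 'i)^-1 * vline_integral (fun s => W s * V (- s)).

(* The inner products are real for real w, whence the real sequence ws. *)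
Definition is_claguerre_spectrum (p : R) w (ws : nat -> R) : Prop :=
  exists2 W, is_laplace_transform w W &
    forall j, (ws j)%:C = cinner W (claguerre p j).

End ContinuousTime.

Section DiscreteTime.
Context {R : realType}.
Implicit Types (w : nat -> R) (W V : R[i] -> R[i]).

Definition l2_sequence w : Prop := cvgn (series (fun t => w t ^+ 2)).

(* Truncated subtraction on nat, hence the explicit test. *)
Definition ddelay (tau : nat) w : nat -> R :=
  fun t => if (t < tau)%N then 0 else w (t - tau)%N.

Definition zseries w (z : R[i]) : R[i] :=
  limn (series (fun t => (w t)%:C * z ^- t.+1 : R[i]^o)).

(* The Hardy space element attached to w: the series outside the closed unit
   disc, and on the unit circle the L_2 boundary values, i.e. the L_2 limit of
   W(r e^(i theta)) as r -> 1+. For w in l^2 such a W exists and is unique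
   almost everywhere on the circle. *)
Definition is_ztransform w W : Prop :=
  [/\ forall z, 1 < ComplexField.Normc.normc z -> W z = zseries w z,
      square_integrable `[0, 2 * pi] (fun theta => W (cexp (theta *i))) &
      l2_dist2 `[0, 2 * pi] (fun theta => W (r%:C * cexp (theta *i)))
          (fun theta => W (cexp (theta *i)))
        @[r --> (1 : R)^'+] --> 0%E].

Definition dlaguerre (p : R) (j : nat) (z : R[i]) : R[i] :=
  let xi := (Num.sqrt p)%:C in
  (Num.sqrt (1 - p))%:C / (z - xi) * ((1 - xi * z) / (z - xi)) ^+ j.

Definition dinner W V : R[i] :=
  (2 * pi%:C * 'i)^-1 * circle_integral (fun z => W z * V z^-1 / z).

Definition is_dlaguerre_spectrum (p : R) w (ws : nat -> R) : Prop :=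
  exists2 W, is_ztransform w W &
    forall j, (ws j)%:C = dinner W (dlaguerre p j).

End DiscreteTime.

Section MarkovParameters.
Context {F : fieldType}.
Implicit Types u y : nat -> F.

(* [:: g_0; ...; g_(n-1)], where g is characterized by recip_coef0 and
   recip_coefS *)
Fixpoint recip_coefs u (n : nat) : seq F :=
  if n is k.+1 then
    let g := recip_coefs u k in
    rcons g (if k is 0 then (u 0)^-1
             else - (u 0)^-1 * \sum_(j < k) u (k - j)%N * g`_j)
  else [::].

Definition recip_coef u k : F := (recip_coefs u k.+1)`_k.

Definition markov_parameter u y k : F :=
  \sum_(j < k.+1) recip_coef u (k - j)%N * y j.

Lemma size_recip_coefs u n : size (recip_coefs u n) = n.
Proof. by elim: n => //= n IH; rewrite size_rcons IH. Qed.

Lemma nth_recip_coefs u n k : (k < n)%N -> (recip_coefs u n)`_k = recip_coef u k.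
Proof.
elim: n => // n IH; rewrite ltnS leq_eqVlt => /predU1P[-> //|kn].
by rewrite [LHS]/= nth_rcons size_recip_coefs kn IH.
Qed.

Lemma recip_coef0 u : recip_coef u 0 = (u 0)^-1.
Proof. by []. Qed.

Lemma recip_coefS u k : (0 < k)%N ->
  recip_coef u k = - (u 0)^-1 * \sum_(j < k) u (k - j)%N * recip_coef u j.
Proof.
case: k => // k _; rewrite {1}/recip_coef.
have -> : recip_coefs u k.+2 = rcons (recip_coefs u k.+1)
  (- (u 0)^-1 * \sum_(j < k.+1) u (k.+1 - j)%N * (recip_coefs u k.+1)`_j) by [].
rewrite nth_rcons size_recip_coefs ltnn eqxx; congr (_ * _).
by apply: eq_bigr => j _; rewrite nth_recip_coefs.
Qed.

End MarkovParameters.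

(* Main.v *)
Require Import Defs.
From HB Require Import structures.
From mathcomp Require Import all_boot all_order all_algebra.
From mathcomp Require Import all_classical all_reals all_analysis.
From mathcomp Require Import measurable_realfun ring lra.
From mathcomp.real_closed Require Import complex.

Set Implicit Arguments.
Unset Strict Implicit.
Unset Printing Implicit Defensive.

Import Order.TTheory GRing.Theory Num.Theory.
Import numFieldNormedType.Exports.
Local Open Scope classical_set_scope.
Local Open Scope ring_scope.

(* For real l near 0, summing the geometric series in l under the inner product
   gives sum_j l^j w_j = C(l) <W, R_a>, where R_a is the resolvent kernel
   1 / (a - i omega) with a = p (1 + l) / (1 - l) in continuous time, and
   1 / (e^(-i theta) - b) with b = (xi + l) / (1 + xi l) in discrete time, and
   C does not depend on W. The pairing with R_a behaves like evaluation of W at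
   a real point, hence a delay multiplies it by H(l) = e^(-a tau), resp.
   H(l) = b^tau. So y = H u as formal power series in l, H is the generating
   series of the Markov parameters, and the claim is the coefficient form of
   (1 - l)^2 H' = - kappa H, resp.
   (1 + (xi + 1/xi) l + l^2) H' = tau (1/xi - xi) H.
   In continuous time the effect of the delay is proved on the lines
   Re s = x > 0, where W is an absolutely convergent integral, by Fejer
   summation in omega; the boundary values are reached by L_2 convergence. *)

(** * Recurrences from linear differential equations *)

Section PowerSeries.
Context {R : realType}.
Implicit Types (p q : {poly R}) (u y : nat -> R).

(** The power series identities are handled as expansions with error O(|l|^n) for every n: a finite
    geometric sum leaves an exact remainder, and a polynomial of size O(|l|^n) near 0 has no
    coefficient below degree n. The factor enters as G = 1 / H, with G Y = U: if P truncates the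
    formal solution of the equation for H, then (G P)' vanishes to high order, which gives G P = 1 +
    O(|l|^n) without any higher derivative of H. In continuous time Fubini does not apply directly
    to <W, R_a>, because R_a decays only like 1 / |omega| on the axis. The triangular Fejer weight
    restores absolute integrability, and its cosine transform is nonnegative and O(1 / (N v^2)),
    hence negligible away from v = 0. In discrete time, on a circle of radius r > 1, term by term
    integration is available. In neither case is the pairing of R_a with a single exponential
    evaluated: only its behaviour under a shift matters. As the spectra are real, only real parts of
    the inner products are used. *)

Lemma horner_bounded p : exists2 B, 0 <= B & forall x : R, `|x| <= 1 -> `|p.[x]| <= B.
Proof.
exists (\sum_(i < size p) `|p`_i|); first exact: sumr_ge0.
move=> x x1; rewrite horner_coef (le_trans (ler_norm_sum _ _ _))//.
apply: ler_sum => i _; rewrite normrM normrX.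
by rewrite ler_piMr// exprn_ile1.
Qed.

Lemma horner_vanishing n p : (forall i, (i < n)%N -> p`_i = 0) ->
  exists2 C, 0 <= C & forall x : R, `|x| <= 1 -> `|p.[x]| <= C * `|x| ^+ n.
Proof.
move=> p0; have [B B0 hB] := horner_bounded (drop_poly n p).
exists B => // x x1; rewrite -(poly_take_drop n p) hornerD hornerM hornerXn.
have -> : take_poly n p = 0.
  by apply/polyP => i; rewrite coef_take_poly coef0; case: ifP => // /p0.
by rewrite horner0 add0r normrM normrX ler_wpM2r ?exprn_ge0// hB.
Qed.

(** Letting x tend to 0 kills the constant coefficient; then p is divisible by X, and the quotient
    obeys the bound with exponent n - 1. This division by x is why the bound is asked only for x !=
    0. *)
Lemma vanishing_coef n p (C d : R) : 0 < d ->
    (forall x : R, x != 0 -> `|x| < d -> `|p.[x]| <= C * `|x| ^+ n) ->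
  forall i, (i < n)%N -> p`_i = 0.
Proof.
move=> d0; elim: n p => // n IH p pC.
have p0 : p`_0 = 0.
  rewrite -horner_coef0; apply/eqP; rewrite -normr_le0.
  have cp : `|p.[x]| @[x --> 0^'] --> `|p.[0]|.
    apply: cvg_norm; apply: cvg_within_filter; exact: continuous_horner.
  have cr : C * `|x| ^+ n.+1 @[x --> (0:R)^'] --> C * `|0 : R| ^+ n.+1.
    apply: cvgMr; apply: cvg_within_filter.
    apply: (continuous_comp (f := @Num.norm R R) (g := fun z : R => z ^+ n.+1)).
      exact: norm_continuous.
    exact: exprn_continuous.
  suff : `|p.[0]| <= C * `|0 : R| ^+ n.+1 by rewrite normr0 expr0n mulr0.
  apply: (ler_cvg_to cp cr).
  near=> x; apply: pC.
    by near: x; exact: nbhs_dnbhs_neq.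
  near: x; apply: dnbhs0_lt => //.
have pX : p = drop_poly 1 p * 'X.
  rewrite -[LHS](poly_take_drop 1%N) expr1.
  suff -> : take_poly 1 p = 0 by rewrite add0r.
  by apply/polyP => -[|i]; rewrite coef_take_poly coef0//=.
case=> // i; rewrite ltnS => i_n.
rewrite -(addn1 i) -coef_drop_poly; apply: IH i_n => x x0 xd.
have := pC x x0 xd; rewrite {1}pX hornerM hornerX normrM exprSr mulrA.
by rewrite ler_pM2r// normr_gt0.
Unshelve. all: by end_near. Qed.


(** Mean value theorem between 0 and x: the intermediate point is no further from 0 than x, so
    passing to a primitive gains one order. *)
Lemma vanishing_primitive n (F F' : R -> R) (C d : R) :
    (forall x : R, `|x| < d -> is_derive x 1 F (F' x)) ->
    (forall x : R, `|x| < d -> `|F' x| <= C * `|x| ^+ n) -> 0 <= C ->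
  forall x : R, `|x| < d -> `|F x - F 0| <= C * `|x| ^+ n.+1.
Proof.
move=> dF F'C C0 x xd.
have cF (a b : R) : `|a| < d -> `|b| < d -> {within `[a, b], continuous F}.
  move=> ad bd; apply: continuous_in_subspaceT => z /[!inE]/= /[!in_itv]/= /andP[az zb].
  have zd : `|z| < d.
    by move: ad bd; rewrite !ltr_norml => /andP[? ?] /andP[? ?]; lra.
  by apply: differentiable_continuous; apply/derivable1_diffP; case: (dF _ zd).
have key (a b c : R) : `|a| < d -> `|b| < d -> `|c| <= `|x| -> `|b - a| = `|x| ->
   F b - F a = F' c * (b - a) -> `|F b - F a| <= C * `|x| ^+ n.+1.
  move=> ad bd cx bax ->; rewrite normrM bax exprSr mulrA ler_wpM2r//.
  rewrite (le_trans (F'C _ (le_lt_trans cx xd)))// ler_wpM2l//.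
  by rewrite lerXn2r ?nnegrE.
have d0 : `|0 : R| < d by rewrite normr0 (le_lt_trans _ xd).
have [x0|x0] := leP 0 x.
  have dz z : z \in `]0, x[ -> is_derive z 1 F (F' z).
    rewrite in_itv/= => /andP[z0 zx]; apply: dF.
    by rewrite gtr0_norm// (lt_trans zx)// -(ger0_norm x0).
  have [c] := MVT_segment x0 dz (cF _ _ d0 xd).
  rewrite in_itv/= => /andP[c0 cx]; apply: key => //; last by rewrite subr0.
  by rewrite !ger0_norm.
have dz z : z \in `]x, 0[ -> is_derive z 1 F (F' z).
  rewrite in_itv/= => /andP[xz z0]; apply: dF.
  by rewrite ltr0_norm//; move: xd; rewrite ltr0_norm// => xd; lra.
have [c] := MVT_segment (ltW x0) dz (cF _ _ xd d0).
rewrite in_itv/= => /andP[xc c0]; rewrite [in X in _ -> X]distrC; apply: key => //.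
  by rewrite (ltr0_norm x0) ler0_norm//; lra.
by rewrite sub0r normrN.
Qed.

Lemma is_derive_bounded (G : R -> R) (g : R) : is_derive (0 : R) 1 G g ->
  exists2 e : R, 0 < e & forall x : R, `|x| < e -> `|G x| <= `|G 0| + 1.
Proof.
move=> dG; have : continuous_at 0 G.
  by apply: differentiable_continuous; apply/derivable1_diffP; case: dG.
move=> /cvgr_dist_lt /(_ 1 ltr01) /nbhs_ballP[e /= e0 eG]; exists e => // x xe.
have := eG x; rewrite /ball/= sub0r normrN => /(_ xe) /ltW.
rewrite distrC => Gx; rewrite -[X in `|X| <= _](subrK (G 0)) addrC.
by rewrite (le_trans (ler_normD _ _))// lerD.
Qed.

(* The pair (c_n, c_(n-1)) for the solution of
   (n + 1) c_(n+1) + al n c_n + (n - 1) c_(n-1) = rho c_n with c_(-1) = 0. *)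
Fixpoint ode_coefs (al rho c0 : R) n : R * R :=
  if n is k.+1 then
    let: (a, b) := ode_coefs al rho c0 k in
    ((rho * a - al * k%:R * a - k.-1%:R * b) / k.+1%:R, a)
  else (c0, 0).

Definition ode_coef (al rho c0 : R) n := (ode_coefs al rho c0 n).1.

Lemma ode_coefP (al rho c0 : R) n :
  n.+1%:R * ode_coef al rho c0 n.+1 + al * n%:R * ode_coef al rho c0 n
   + n.-1%:R * ode_coef al rho c0 n.-1 = rho * ode_coef al rho c0 n.
Proof.
have n0 : n.+1%:R != 0 :> R by rewrite pnatr_eq0.
case: n n0 => [|n] n0; rewrite /ode_coef.
  by rewrite /= !mulr0 !mul0r !addr0 subr0 subr0 divr1 mul1r.
have <- : (ode_coefs al rho c0 n.+1).2 = (ode_coefs al rho c0 n.+1.-1).1.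
  by rewrite /=; case: (ode_coefs _ _ _ n).
have -> : ode_coefs al rho c0 n.+2 = let: (a, b) := ode_coefs al rho c0 n.+1 in
    ((rho * a - al * n.+1%:R * a - n%:R * b) / n.+2%:R, a) by [].
case: (ode_coefs al rho c0 n.+1) => a b; rewrite /fst /snd.
by rewrite /=; field.
Qed.

(** G solves the equation with -rho, so 1 / G solves the one whose formal solution is [ode_coef].
    Showing that the product of G and the truncation has a small derivative replaces both a
    uniqueness theorem and the Taylor expansion of 1 / G. *)
Lemma ode_coef_taylor (al rho : R) (G G' : R -> R) d n : 0 < d ->
    (forall x : R, `|x| < d -> is_derive x 1 G (G' x)) ->
    (forall x : R, `|x| < d -> (1 + al * x + x ^+ 2) * G' x = - rho * G x) ->
    G 0 != 0 ->
  exists C e, [/\ 0 <= C, 0 < e & forall x : R, `|x| < e ->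
  `|G x * (\poly_(i < n.+1) ode_coef al rho (G 0)^-1 i).[x] - 1| <= C * `|x| ^+ n.+1].
Proof.
move=> d0 dG qG G0; set c := ode_coef al rho (G 0)^-1.
set P := \poly_(i < n.+1) c i.
(* The defect of P in the equation. Its coefficient i involves coefficients of P up to i + 1 only,
   so for i < n the truncation is not felt and the recurrence makes it 0. *)
pose D := P^`() + al *: ('X * P^`()) + 'X * ('X * P^`()) - rho *: P.
have [C C0 DC] : exists2 C, 0 <= C &
    forall x : R, `|x| <= 1 -> `|D.[x]| <= C * `|x| ^+ n.
  apply: horner_vanishing => i i_n.
  rewrite /D coefB !coefD !coefZ !coefXM !coef_deriv !coef_poly ltnS i_n.
  rewrite (ltn_trans i_n)//.
  have := ode_coefP al rho (G 0)^-1 i; rewrite -/c => <-.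
  case: i i_n => [|[|i]] i_n /=; rewrite ?coef_deriv ?coef_poly ?ltnS.
  - ring.
  - by rewrite ltnW//; ring.
  - by rewrite (ltnW i_n) (ltnW (ltnW i_n)); ring.
have dG0 : is_derive (0 : R) 1 G (G' 0) by apply: dG; rewrite normr0.
have [e1 e10 GB] := is_derive_bounded dG0.
(* For |x| < e2 this gives |al x + x^2| <= 1/2, so the quadratic factor is at least 1/2 in absolute
   value; dividing by it costs the factor 2 in the constant. *)
pose e2 := (2 * (`|al| + 1))^-1.
have al0 : 0 < `|al| + 1 by rewrite ltr_wpDl.
have e20 : 0 < e2 by rewrite invr_gt0 mulr_gt0.
have e2E : e2 * (`|al| + 1) = 2^-1.
  by rewrite /e2; field; rewrite gt_eqF.
have e2h : e2 <= 1 by have := normr_ge0 al; move=> ?; nra.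
pose e := Num.min (Num.min d e1) e2.
exists (2 * ((`|G 0| + 1) * C)), e.
have B0 : 0 <= 2 * ((`|G 0| + 1) * C) by rewrite !mulr_ge0// addr_ge0.
split => //; first by rewrite !lt_min d0 e10.
(* (1 + al x + x^2) (G P)' = G D, and D vanishes to order n. *)
pose F' x := G x * (P^`()).[x] + P.[x] * G' x.
have FD (x : R) : `|x| < e -> (1 + al * x + x ^+ 2) * F' x = G x * D.[x].
  rewrite !lt_min => /andP[/andP[xd _] _].
  have -> : D.[x] = P^`().[x] + al * (x * P^`().[x]) + x * (x * P^`().[x]) - rho * P.[x].
    by rewrite /D hornerD hornerN !hornerD !hornerZ !hornerM !hornerX.
  rewrite /F'; have := qG _ xd; rewrite expr2.
  move: P.[x] P^`().[x] (G x) (G' x) => a b g g' qx.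
  by rewrite mulrDr (mulrCA _ a) qx; ring.
have F'C (x : R) : `|x| < e -> `|F' x| <= 2 * ((`|G 0| + 1) * C) * `|x| ^+ n.
  move=> xe; have := FD _ xe; move: xe.
  rewrite !lt_min => /andP[/andP[xd xe1] xe2] FDx.
  have x1 : `|x| <= 1 by rewrite (le_trans (ltW xe2)).
  have qh : 2^-1 <= `|1 + al * x + x ^+ 2|.
    have : `|al * x + x ^+ 2| <= 2^-1.
      rewrite (le_trans (ler_normD _ _))// -e2E normrM normrX.
      have := normr_ge0 al; have := normr_ge0 x; move: (`|al|) (`|x|) xe2 x1 => a b.
      by move=> ? ? ? ?; nra.
    by rewrite -addrA; move: (al * x + _) => t /ler_normlP[? ?]; rewrite ler_normr; apply/orP; left; lra.
  have : `|(1 + al * x + x ^+ 2) * F' x| <= (`|G 0| + 1) * (C * `|x| ^+ n).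
    by rewrite FDx normrM ler_pM// ?GB ?DC.
  rewrite normrM -!mulrA => h.
  have : 2^-1 * `|F' x| <= (`|G 0| + 1) * (C * `|x| ^+ n).
    by rewrite (le_trans _ h)// ler_wpM2r.
  by move=> ?; lra.
have dF (x : R) : `|x| < e -> is_derive x 1 (fun x => G x * P.[x]) (F' x).
  rewrite !lt_min => /andP[/andP[xd _] _]; have ? := dG _ xd.
  by apply: is_deriveM.
move=> x xe; have := vanishing_primitive dF F'C B0 xe.
have -> : P.[0] = (G 0)^-1 by rewrite horner_coef0 coef_poly.
by rewrite divff.
Qed.

(** [recip_coef] is the inverse of u as a power series, so y = c u gives h = u^-1 y = c. Truncated
    polynomials can carry the computation, because coefficients below n of a product only see
    coefficients below n. *)
Lemma markov_conv n u y (c : nat -> R) : u 0%N != 0 ->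
    (forall j, (j < n)%N -> y j = \sum_(i < j.+1) c i * u (j - i)%N) ->
  forall k, (k < n)%N -> markov_parameter u y k = c k.
Proof.
move=> u0 yE k kn.
pose p (f : nat -> R) := \poly_(i < n) f i.
have pE f i : (i < n)%N -> (p f)`_i = f i by move=> i_n; rewrite coef_poly i_n.
set g := recip_coef u.
have gu i : (i < n)%N -> (p g * p u)`_i = (i == 0)%:R.
  move=> i_n; rewrite coefM.
  under eq_bigr => j _.
    have ji : (j <= i)%N by rewrite -ltnS.
    rewrite !pE ?(leq_ltn_trans (leq_subr _ _))// ?(leq_ltn_trans ji)//; over.
  rewrite big_ord_recr/= subnn; case: i i_n => [|i] i_n.
    by rewrite big_ord0 add0r /g recip_coef0 mulVf.
  rewrite /g recip_coefS// mulrAC mulNr mulVf// mulN1r.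
  by apply/eqP; rewrite subr_eq0; apply/eqP/eq_bigr => j _; rewrite mulrC.
have -> : markov_parameter u y k = (p g * p y)`_k.
  rewrite coefMr /markov_parameter; apply: eq_bigr => j _.
  by rewrite !pE// ?(leq_ltn_trans _ kn) ?leq_subr// -ltnS.
rewrite coefMr.
transitivity (\sum_(j < k.+1) (p g)`_(k - j) * (p c * p u)`_j).
  apply: eq_bigr => j _; congr (_ * _).
  have jn : (j < n)%N by rewrite (leq_ltn_trans _ kn)// -ltnS.
  rewrite pE// yE// coefM; apply: eq_bigr => i _.
  by rewrite !pE// ?(leq_ltn_trans _ jn) ?leq_subr// -ltnS.
rewrite -coefMr mulrCA coefMr big_ord_recl subn0 gu ?(leq_ltn_trans _ kn)//.
rewrite mulr1 pE// big1 ?addr0// => i _.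
by rewrite gu ?mulr0// lift0 (leq_ltn_trans _ kn).
Qed.

(** From G Y = U and G P = 1 up to errors of order n follows Y = P U up to order n, so the Markov
    parameters are the [ode_coef]. At m = 0 the convention [m.-1 = 0] is harmless, since the factor
    [m.-1%:R] is 0. *)
Lemma markov_recurrence (al rho d : R) (G G' : R -> R) u y : 0 < d ->
    (forall x : R, `|x| < d -> is_derive x 1 G (G' x)) ->
    (forall x : R, `|x| < d -> (1 + al * x + x ^+ 2) * G' x = - rho * G x) ->
    G 0 != 0 -> u 0%N != 0 ->
    (forall n, exists C e, 0 < e /\ forall x : R, `|x| < e ->
       `|G x * \sum_(j < n) y j * x ^+ j - \sum_(j < n) u j * x ^+ j| <= C * `|x| ^+ n) ->
  forall m, let h := markov_parameter u y in
  m.+1%:R * h m.+1 + al * m%:R * h m + m.-1%:R * h m.-1 = rho * h m.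
Proof.
move=> d0 dG qG G0 u0 Guy m /=.
(* The recurrence at m involves indices up to m + 1, so order m + 2 is enough. *)
pose n := m.+2; have [C1 [e1 [C10 e10 GP]]] := ode_coef_taylor m.+1 d0 dG qG G0.
have [C2 [e2 [e20 GU]]] := Guy n.
set c := ode_coef al rho (G 0)^-1 in GP.
pose p (f : nat -> R) := \poly_(i < n) f i.
have pE f x : (p f).[x] = \sum_(j < n) f j * x ^+ j by rewrite horner_poly.
have [BP BP0 hP] := horner_bounded (p c); have [BY BY0 hY] := horner_bounded (p y).
have yE j : (j < n)%N -> y j = \sum_(i < j.+1) c i * u (j - i)%N.
  move=> jn; have e0 : 0 < Num.min (Num.min e1 e2) 1 by rewrite !lt_min e10 e20/=.
  have : forall x : R, x != 0 -> `|x| < Num.min (Num.min e1 e2) 1 ->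
      `|(p y - p c * p u).[x]| <= (BP * C2 + BY * C1) * `|x| ^+ n.
    move=> x _; rewrite !lt_min => /andP[/andP[xe1 xe2] /ltW x1].
    rewrite hornerD hornerN hornerM.
    (* Both parentheses on the right are O(|x|^n), and their cofactors are bounded for |x| <= 1. *)
    have -> : (p y).[x] - (p c).[x] * (p u).[x] =
      (p c).[x] * (G x * (p y).[x] - (p u).[x]) - (p y).[x] * (G x * (p c).[x] - 1).
      by ring.
    rewrite (le_trans (ler_normB _ _))// mulrDl -!mulrA !normrM lerD// ler_pM// ?hP ?hY//.
      by rewrite !pE; exact: GU.
    exact: GP.
  move=> /(vanishing_coef e0)/(_ _ jn); rewrite coefB => /eqP; rewrite subr_eq0 => /eqP.
  rewrite coef_poly jn => ->; rewrite coefM; apply: eq_bigr => i _.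
  by rewrite !coef_poly !ifT ?(leq_ltn_trans _ jn) ?leq_subr// -ltnS.
rewrite !(markov_conv u0 yE) ?ltnS//; first exact: ode_coefP.
by rewrite (leq_trans (leq_pred _)).
Qed.

End PowerSeries.

(** * Square-integrable complex functions *)

Section RealIntegrals.
Context d (T : measurableType d) (R : realType) (mu : {measure set T -> \bar R}).
Variable D : set T.
Hypothesis mD : measurable D.
Implicit Types f g : T -> R.

Lemma integrable_le f g : measurable_fun D f ->
    (forall x, D x -> `|f x| <= g x) ->
  mu.-integrable D (EFin \o g) -> mu.-integrable D (EFin \o f).
Proof.
move=> mf fg ig; apply: (le_integrable mD _ _ ig); first exact/measurable_EFinP.
by move=> x Dx; rewrite /= lee_fin (le_trans (fg _ Dx))// ler_norm.
Qed.

Lemma integrable_mull f (c : R) : mu.-integrable D (EFin \o f) ->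
  mu.-integrable D (EFin \o (fun x => c * f x)).
Proof.
move=> iF; rewrite /comp; under eq_fun do rewrite EFinM.
exact: (integrableZl mD c iF).
Qed.

Lemma integrable_add f g : mu.-integrable D (EFin \o f) -> mu.-integrable D (EFin \o g) ->
  mu.-integrable D (EFin \o (fun x => f x + g x)).
Proof.
move=> iF iG; rewrite /comp; under eq_fun do rewrite EFinD.
exact: (integrableD mD iF iG).
Qed.

Lemma integrable_sub f g : mu.-integrable D (EFin \o f) -> mu.-integrable D (EFin \o g) ->
  mu.-integrable D (EFin \o (fun x => f x - g x)).
Proof.
move=> iF iG; rewrite /comp; under eq_fun do rewrite EFinB.
exact: (integrableB mD iF iG).
Qed.

Lemma integrable_normr f : mu.-integrable D (EFin \o f) ->
  mu.-integrable D (EFin \o (fun x => `|f x|)).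
Proof. by move=> iF; exact: (integrable_norm iF). Qed.

End RealIntegrals.

Section SquareIntegrable.
Context {R : realType}.
Local Notation mu := (@lebesgue_measure R).
Local Notation normc := ComplexField.Normc.normc.
Implicit Types (D : set (measurableTypeR R)) (f g W k : R -> R[i]).

Definition cmeasurable D f : Prop :=
  measurable_fun D (fun x => complex.Re (f x)) /\
  measurable_fun D (fun x => complex.Im (f x)).

Lemma ReM (a b : R[i]) : complex.Re (a * b) =
  complex.Re a * complex.Re b - complex.Im a * complex.Im b.
Proof. by case: a b => [? ?] [? ?]. Qed.

Lemma ImM (a b : R[i]) : complex.Im (a * b) =
  complex.Re a * complex.Im b + complex.Im a * complex.Re b.
Proof. by case: a b => [? ?] [? ?]. Qed.

Lemma ReB (a b : R[i]) : complex.Re (a - b) = complex.Re a - complex.Re b.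
Proof. by case: a b => [? ?] [? ?]. Qed.

Lemma ImB (a b : R[i]) : complex.Im (a - b) = complex.Im a - complex.Im b.
Proof. by case: a b => [? ?] [? ?]. Qed.

Lemma ReD (a b : R[i]) : complex.Re (a + b) = complex.Re a + complex.Re b.
Proof. by case: a b => [? ?] [? ?]. Qed.

Lemma ReZ (l : R) (a : R[i]) : complex.Re (l%:C%C * a) = l * complex.Re a.
Proof. by case: a => ? ? /=; rewrite mul0r subr0. Qed.

Lemma ReV (a : R[i]) : complex.Re a^-1 =
  complex.Re a * (complex.Re a ^+ 2 + complex.Im a ^+ 2)^-1.
Proof. by case: a => [? ?]. Qed.

Lemma ImV (a : R[i]) : complex.Im a^-1 =
  - (complex.Im a * (complex.Re a ^+ 2 + complex.Im a ^+ 2)^-1).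
Proof. by case: a. Qed.

Lemma sqr_normc (a : R[i]) : normc a ^+ 2 = complex.Re a ^+ 2 + complex.Im a ^+ 2.
Proof. by case: a => x y /=; rewrite sqr_sqrtr// addr_ge0 ?sqr_ge0. Qed.

Lemma normc_ge0 (a : R[i]) : 0 <= normc a.
Proof. by case: a => x y /=; exact: sqrtr_ge0. Qed.

Lemma normcX (a : R[i]) n : normc (a ^+ n) = normc a ^+ n.
Proof.
elim: n => [|n IH]; first by rewrite !expr0 ComplexField.Normc.normc1.
by rewrite !exprS ComplexField.Normc.normcM IH.
Qed.

Lemma normcR (a : R) : normc a%:C%C = `|a|.
Proof. by rewrite /= expr0n/= addr0 sqrtr_sqr. Qed.

Lemma Re_le_normc (a : R[i]) : `|complex.Re a| <= normc a.
Proof.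
case: a => x y /=; rewrite -sqrtr_sqr ler_sqrt ?lerDl ?sqr_ge0//.
by rewrite addr_ge0 ?sqr_ge0.
Qed.

Lemma normc_unit_sub (l : R) (m : R[i]) : `|l| <= 2^-1 -> normc m = 1 ->
  2^-1 <= normc (1 - l%:C%C * m).
Proof.
move=> l2 m1; apply: le_trans (Re_le_normc _).
have : `|complex.Re (l%:C%C * m)| <= 2^-1.
  by rewrite (le_trans (Re_le_normc _))// ComplexField.Normc.normcM m1 mulr1 normcR.
rewrite ReB /=; move: (complex.Re _) => r /ler_normlP[? ?].
by rewrite ler_normr; apply/orP; left; lra.
Qed.

Lemma normc_gt0_neq0 (a : R[i]) : 0 < normc a -> a != 0.
Proof. by apply: contraTneq => ->; rewrite ComplexField.Normc.normc0 ltxx. Qed.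

Lemma cmeasurableM D f g : measurable D -> cmeasurable D f -> cmeasurable D g ->
  cmeasurable D (fun x => f x * g x).
Proof.
move=> mD [fr fi] [gr gi]; split.
  under eq_fun do rewrite ReM.
  by apply: measurable_funB; exact: measurable_funM.
under eq_fun do rewrite ImM.
by apply: measurable_funD; exact: measurable_funM.
Qed.

Lemma cmeasurableB D f g : measurable D -> cmeasurable D f -> cmeasurable D g ->
  cmeasurable D (fun x => f x - g x).
Proof.
move=> mD [fr fi] [gr gi]; split.
  by under eq_fun do rewrite ReB; exact: measurable_funB.
by under eq_fun do rewrite ImB; exact: measurable_funB.
Qed.

Lemma cmeasurable_cst D (c : R[i]) : cmeasurable D (fun=> c).
Proof. by split; exact: measurable_cst. Qed.

Lemma cmeasurableX D f n : measurable D -> cmeasurable D f ->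
  cmeasurable D (fun x => f x ^+ n).
Proof.
move=> mD mf; elim: n => [|n IH].
  by under eq_fun do rewrite expr0; exact: cmeasurable_cst.
by under eq_fun do rewrite exprS; exact: cmeasurableM.
Qed.

Lemma measurable_sqr_normc D f : measurable D -> cmeasurable D f ->
  measurable_fun D (fun x => normc (f x) ^+ 2).
Proof.
move=> mD [fr fi]; under eq_fun do rewrite sqr_normc.
by apply: measurable_funD; exact: measurable_funX.
Qed.

Lemma cmeasurableV D f : measurable D -> cmeasurable D f ->
  cmeasurable D (fun x => (f x)^-1).
Proof.
move=> mD mf.
have mV : measurable_fun D
    (fun x => (complex.Re (f x) ^+ 2 + complex.Im (f x) ^+ 2)^-1).
  (* On nonnegative reals the inverse is the power -1, a measurable function on the whole line, so f
     may vanish somewhere. *)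
  under eq_fun => x do rewrite -powR_inv1 ?addr_ge0 ?sqr_ge0//.
  apply: (measurableT_comp (measurable_powR (-1))).
  under eq_fun do rewrite -sqr_normc.
  exact: measurable_sqr_normc.
case: mf => fr fi; split.
  by under eq_fun do rewrite ReV; exact: measurable_funM.
under eq_fun do rewrite ImV; apply: measurable_funN; exact: measurable_funM.
Qed.

Lemma square_integrableP D f : measurable D ->
  square_integrable D f <->
  cmeasurable D f /\ mu.-integrable D (EFin \o (fun x => normc (f x) ^+ 2)).
Proof.
move=> mD; split.
  move=> [mr mi foo]; split=> //; apply/integrableP; split.
    by apply/measurable_EFinP; exact: measurable_sqr_normc.
  by under eq_integral do rewrite /= ger0_norm ?sqr_ge0//.
move=> [mf /integrableP[_ foo]]; case: (mf) => mr mi; split => //.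
by move: foo; under eq_integral do rewrite /= ger0_norm ?sqr_ge0//.
Qed.

Definition norm2 D f : R := \int[mu]_(x in D) (normc (f x) ^+ 2).

Lemma square_integrable_le D f g (c : R) : measurable D -> 0 <= c ->
    square_integrable D g -> cmeasurable D f ->
    (forall x, D x -> normc (f x) <= c * normc (g x)) ->
  square_integrable D f /\ norm2 D f <= c ^+ 2 * norm2 D g.
Proof.
move=> mD c0 /(square_integrableP _ mD)[mg ig] mf fg.
have fg2 x : D x -> normc (f x) ^+ 2 <= c ^+ 2 * normc (g x) ^+ 2.
  by move=> Dx; rewrite -exprMn lerXn2r ?nnegrE ?mulr_ge0 ?normc_ge0 ?fg.
have icg : mu.-integrable D (EFin \o (fun x => c ^+ 2 * normc (g x) ^+ 2)).
  exact: integrable_mull.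
have if_ : mu.-integrable D (EFin \o (fun x => normc (f x) ^+ 2)).
  apply: (integrable_le mD _ _ icg); first exact: measurable_sqr_normc.
  by move=> x Dx; rewrite ger0_norm ?sqr_ge0//; exact: fg2.
split; first exact/square_integrableP.
by rewrite /norm2 -RintegralZl//; exact: le_Rintegral.
Qed.

(** Only the real part is kept, since the real parts of the inner products determine the real
    spectra. There is no conjugation: the inner products pair W(s) with V(-s), or W(z) with
    V(1/z). *)
Definition pairing D W k : R := \int[mu]_(x in D) complex.Re (W x * k x).

Lemma Re_mul_le (a b : R[i]) (e : R) : 0 < e ->
  `|complex.Re (a * b)| <= e^-1 * normc a ^+ 2 + e * normc b ^+ 2.
Proof.
move=> e0; rewrite (le_trans (Re_le_normc _))// ComplexField.Normc.normcM.
have := normc_ge0 a; have := normc_ge0 b; move: (normc a) (normc b) => x y y0 x0.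
rewrite -subr_ge0.
have -> : e^-1 * x ^+ 2 + e * y ^+ 2 - x * y = e^-1 * ((x - e * y) ^+ 2 + e * (x * y)).
  by field; rewrite gt_eqF.
by rewrite mulr_ge0 ?invr_ge0 ?addr_ge0 ?sqr_ge0 ?mulr_ge0 ?(ltW e0).
Qed.

Lemma pairing_integrable D W k : measurable D ->
    square_integrable D W -> square_integrable D k ->
  mu.-integrable D (EFin \o (fun x => complex.Re (W x * k x))).
Proof.
move=> mD /(square_integrableP _ mD)[mW iW] /(square_integrableP _ mD)[mk ik].
apply: (integrable_le mD _ _ (integrable_add mD iW ik)).
  exact: (cmeasurableM mD mW mk).1.
by move=> x Dx; have := Re_mul_le (W x) (k x) ltr01; rewrite invr1 !mul1r.
Qed.

(** A weighted arithmetic-geometric mean inequality in place of Cauchy-Schwarz; the free weight e is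
    balanced in [pairing_cvg]. *)
Lemma pairing_le D W k (e : R) : measurable D -> 0 < e ->
    square_integrable D W -> square_integrable D k ->
  `|pairing D W k| <= e^-1 * norm2 D W + e * norm2 D k.
Proof.
move=> mD e0 sW sk; have iWk := pairing_integrable mD sW sk.
rewrite /pairing (le_trans (le_normr_Rintegral mD iWk))//.
move: sW sk => /(square_integrableP _ mD)[mW iW] /(square_integrableP _ mD)[mk ik].
rewrite /norm2 -!RintegralZl//.
rewrite -RintegralD//; [|exact: integrable_mull..].
apply: le_Rintegral => //.
- exact: integrable_normr.
- by apply: integrable_add => //; exact: integrable_mull.
- by move=> x Dx; exact: Re_mul_le.
Qed.

Lemma pairing_linear D W k1 k2 (l : R) : measurable D -> square_integrable D W ->
    square_integrable D k1 -> square_integrable D k2 ->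
  pairing D W (fun x => k1 x + l%:C%C * k2 x) = pairing D W k1 + l * pairing D W k2.
Proof.
move=> mD sW s1 s2; rewrite /pairing -RintegralZl//; last exact: pairing_integrable.
rewrite -RintegralD//; [|exact: pairing_integrable|]; last first.
  exact: (integrable_mull mD l (pairing_integrable mD sW s2)).
apply: eq_Rintegral => x _; rewrite mulrDr ReD; congr (_ + _).
by rewrite mulrCA ReZ.
Qed.

(** [l2_dist2] takes values in the extended reals, so its convergence to 0 also says that it is
    eventually finite. With measurability this makes the approximants square integrable near the
    limit, as needed to split their pairings. *)
Lemma pairing_cvg (F : set_system R) (W_ : R -> R -> R[i]) D W k :
    ProperFilter F -> measurable D -> square_integrable D W -> square_integrable D k ->
    (\forall x \near F, cmeasurable D (W_ x)) ->
    l2_dist2 D (W_ x) W @[x --> F] --> 0%E ->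
  (\forall x \near F, square_integrable D (W_ x)) /\
  pairing D (W_ x) k @[x --> F] --> pairing D W k.
Proof.
move=> FF mD sW sk mW_ /fine_cvgP[fin_d d0].
have /(square_integrableP _ mD)[mW iW] := sW.
have sB : \forall x \near F, square_integrable D (fun t => W_ x t - W t).
  near=> x; have : l2_dist2 D (W_ x) W \is a fin_num by near: x.
  rewrite fin_numElt => /andP[_].
  have mWx : cmeasurable D (W_ x) by near: x.
  have [mr mi] := cmeasurableB mD mWx mW.
  by move=> dx; split; [exact: mr|exact: mi|exact: dx].
have sW_ : \forall x \near F, square_integrable D (W_ x).
  near=> x; have /(square_integrableP _ mD)[mB iB] : square_integrable D (fun t => W_ x t - W t) by near: x.
  have mWx : cmeasurable D (W_ x) by near: x.
  apply/square_integrableP => //; split=> //.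
  (* The bound |a|^2 <= 2 |a - b|^2 + 2 |b|^2, where the difference of the two sides is |a - 2
     b|^2. *)
  apply: (integrable_le mD _ _ (integrable_add mD (integrable_mull mD 2 iB) (integrable_mull mD 2 iW))).
    exact: measurable_sqr_normc.
  move=> t Dt; rewrite ger0_norm ?sqr_ge0// !sqr_normc ReB ImB.
  move: (complex.Re (W_ x t)) (complex.Im (W_ x t)) (complex.Re (W t)) (complex.Im (W t)) => a b c d.
  have : 0 <= (a - 2 * c) ^+ 2 + (b - 2 * d) ^+ 2 by rewrite addr_ge0 ?sqr_ge0.
  by rewrite !expr2; lra.
split=> //; apply/cvgrPdist_le => e e0.
have n2 : 0 <= norm2 D k by apply: Rintegral_ge0 => x _; exact: sqr_ge0.
(* The weight for [pairing_le]: the term with [norm2 D k] is then at most e / 2, and so is the other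
   one once the squared distance is at most h e / 2. The + 1 covers a kernel of norm 0. *)
pose h := e / (2 * (norm2 D k + 1)).
have h0 : 0 < h by rewrite divr_gt0// mulr_gt0// ltr_wpDl.
have he : 0 < h * (e / 2) by rewrite mulr_gt0// divr_gt0.
near=> x.
have sBx : square_integrable D (fun t => W_ x t - W t) by near: x.
have sWx : square_integrable D (W_ x) by near: x.
have -> : pairing D W k - pairing D (W_ x) k = - pairing D (fun t => W_ x t - W t) k.
  apply/eqP; rewrite -eqr_oppLR opprB; apply/eqP; rewrite /pairing.
  rewrite -RintegralB//; [|exact: pairing_integrable..].
  by apply: eq_Rintegral => t _; rewrite mulrBl ReB.
rewrite normrN (le_trans (pairing_le mD h0 sBx sk))//.
have dx : norm2 D (fun t => W_ x t - W t) <= h * (e / 2).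
  rewrite (_ : norm2 _ _ = fine (l2_dist2 D (W_ x) W))//.
  near: x; have := @cvgr_le _ _ _ _ _ _ d0 _ he; exact.
have h2 : h * norm2 D k <= e / 2.
  have <- : h * (norm2 D k + 1) = e / 2 by rewrite /h; field; rewrite gt_eqF// ltr_wpDl.
  by rewrite ler_pM2l// lerDl.
have : h^-1 * norm2 D (fun t => W_ x t - W t) <= e / 2.
  by rewrite ler_pdivrMl.
by lra.
Unshelve. all: by end_near. Qed.

(** The kernel K = k0 / (1 - l m) satisfies K = k0 + l m K. Iterating n times gives the partial sum
    with the exact remainder l^n <W, K m^n>, and |K m^n| <= 2 |k0| when |m| = 1 and |l| <= 1/2;
    hence one C serves all n and l. *)
Lemma pairing_geometric D W (k0 m : R -> R[i]) : measurable D ->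
    square_integrable D W -> square_integrable D k0 -> cmeasurable D m ->
    (forall x, D x -> normc (m x) = 1) ->
  exists C : R, forall n (l : R), `|l| <= 2^-1 ->
  `|pairing D W (fun x => k0 x / (1 - l%:C%C * m x)) -
    \sum_(j < n) pairing D W (fun x => k0 x * m x ^+ j) * l ^+ j| <= C * `|l| ^+ n.
Proof.
move=> mD sW sk mm m1; exists (norm2 D W + 2 ^+ 2 * norm2 D k0) => n l l2.
have [mk ik] := (square_integrableP _ mD).1 sk.
pose K x := k0 x / (1 - l%:C%C * m x).
have mK : cmeasurable D K.
  apply: cmeasurableM => //; apply: cmeasurableV => //; apply: cmeasurableB => //.
  by apply: cmeasurableM => //; exact: (cmeasurable_cst _ l%:C%C).
have sm j : square_integrable D (fun x => k0 x * m x ^+ j).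
  apply: (square_integrable_le (c := 1) mD _ sk _ _).1 => //.
    by apply: cmeasurableM => //; exact: cmeasurableX.
  by move=> x Dx; rewrite ComplexField.Normc.normcM normcX m1// expr1n mulr1 mul1r.
have [sK nK] : (forall j, square_integrable D (fun x => K x * m x ^+ j)) /\
    forall j, norm2 D (fun x => K x * m x ^+ j) <= 2 ^+ 2 * norm2 D k0.
  apply/all_and2 => j; apply: square_integrable_le => //.
    by apply: cmeasurableM => //; exact: cmeasurableX.
  move=> x Dx; rewrite !ComplexField.Normc.normcM normcX m1// expr1n mulr1.
  rewrite ComplexField.Normc.normcV mulrC ler_wpM2r ?normc_ge0//.
  have h := normc_unit_sub l2 (m1 _ Dx).
  by rewrite -[leRHS]invrK lef_pV2 ?posrE ?invr_gt0// (lt_le_trans _ h).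
have step j : pairing D W (fun x => K x * m x ^+ j) =
    pairing D W (fun x => k0 x * m x ^+ j) + l * pairing D W (fun x => K x * m x ^+ j.+1).
  rewrite -pairing_linear//; apply: eq_Rintegral => x /[!inE] Dx.
  congr (complex.Re (_ * _)); rewrite /K.
  have := normc_unit_sub l2 (m1 _ Dx) => h.
  have : 1 - l%:C%C * m x != 0 by apply: normc_gt0_neq0; rewrite (lt_le_trans _ h).
  by move=> h0; rewrite exprS; field.
have -> : pairing D W (fun x => k0 x / (1 - l%:C%C * m x)) =
    \sum_(j < n) pairing D W (fun x => k0 x * m x ^+ j) * l ^+ j
    + l ^+ n * pairing D W (fun x => K x * m x ^+ n).
  elim: n => [|n IH].
    rewrite big_ord0 add0r expr0 mul1r.
    by apply: eq_Rintegral => x _; rewrite expr0 mulr1.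
  by rewrite big_ord_recr/= IH step exprSr; ring.
rewrite addrC addKr normrM normrX mulrC ler_wpM2r ?exprn_ge0//.
have := pairing_le mD ltr01 sW (sK n); rewrite invr1 !mul1r => /le_trans; apply.
by rewrite lerD2l.
Qed.

End SquareIntegrable.

(** * Fejer means of the resolvent kernel *)

Section Fejer.
Context {R : realType}.
Local Notation mu := (@lebesgue_measure R).
Implicit Types (a N v w x : R).

Lemma is_derive_mulr v w : is_derive w 1 (fun x : R => x * v) v.
Proof.
have -> : (fun x : R => x * v) = id * cst v by [].
by apply: is_derive_eq; rewrite /cst /= scaler0 add0r -[_ *: _]/(v * 1) mulr1.
Qed.

Lemma is_derive_mull v w : is_derive w 1 (fun x : R => v * x) v.
Proof.
by under [X in is_derive _ _ X]eq_fun do rewrite mulrC; exact: is_derive_mulr.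
Qed.

Lemma is_derive_sin_mulr v w : is_derive w 1 (fun x : R => sin (x * v)) (cos (w * v) * v).
Proof.
have -> : (fun x : R => sin (x * v)) = sin \o (fun x => x * v) by [].
by apply: is_derive1_comp; exact: is_derive_mulr.
Qed.

Lemma is_derive_cos_mulr v w : is_derive w 1 (fun x : R => cos (x * v)) (- sin (w * v) * v).
Proof.
have -> : (fun x : R => cos (x * v)) = cos \o (fun x => x * v) by [].
by apply: is_derive1_comp; exact: is_derive_mulr.
Qed.

Lemma is_derive_sin_mull v w : is_derive w 1 (fun x : R => sin (v * x)) (cos (v * w) * v).
Proof.
have -> : (fun x : R => sin (v * x)) = (fun x => sin (x * v)).
  by apply/funext => x; rewrite mulrC.
by rewrite (mulrC v w); exact: is_derive_sin_mulr.
Qed.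

Lemma is_derive_cos_mull v w : is_derive w 1 (fun x : R => cos (v * x)) (- sin (v * w) * v).
Proof.
have -> : (fun x : R => cos (v * x)) = (fun x => cos (x * v)).
  by apply/funext => x; rewrite mulrC.
by rewrite (mulrC v w); exact: is_derive_cos_mulr.
Qed.

Lemma is_derive_expR_mull v w : is_derive w 1 (fun x : R => expR (v * x)) (expR (v * w) * v).
Proof.
have -> : (fun x : R => expR (v * x)) = expR \o (fun x => v * x) by [].
by apply: is_derive1_comp; exact: is_derive_mull.
Qed.

Lemma is_derive_continuous (f df : R -> R) :
  (forall x, is_derive x 1 f (df x)) -> continuous f.
Proof.
by move=> fd x; apply: differentiable_continuous; apply/derivable1_diffP; case: (fd x).
Qed.

Lemma integral_is_derive (f F : R -> R) a b : a < b -> continuous f ->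
    (forall x, is_derive x 1 F (f x)) ->
  \int[mu]_(x in `[a, b]) f x = F b - F a.
Proof.
move=> ab cf dF; have cF := is_derive_continuous dF.
rewrite /Rintegral (@continuous_FTC2 _ f F)//.
- exact: continuous_subspaceT.
- split=> [x _||]; first by case: (dF x).
  + by apply: cvg_at_right_filter; exact: cF.
  + by apply: cvg_at_left_filter; exact: cF.
- by move=> x _; rewrite derive1E; apply: (@derive_val _ _ _ _ _ _ _ (dF x)).
Qed.

(** The triangular weight of Cesaro summation. Its compact support makes integrals in w absolutely
    convergent, and its cosine transform is nonnegative. *)
Definition fejer N w : R := Num.max 0 (1 - `|w| / N).

Lemma fejer_ge0 N w : 0 <= fejer N w.
Proof. by rewrite le_max lexx. Qed.

Lemma fejer_le1 N w : 0 < N -> fejer N w <= 1.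
Proof.
by move=> N0; rewrite ge_max ler01/= gerBl divr_ge0// ltW.
Qed.

Lemma continuous_fejer N : continuous (fejer N).
Proof.
move=> w; apply: (@continuous_max R R (cst 0) (fun w => 1 - `|w| / N)).
  exact: cst_continuous.
apply: cvgB; first exact: cvg_cst.
by apply: cvgMl; exact: norm_continuous.
Qed.

Lemma fejer_out N w : 0 < N -> w \notin `[- N, N]%R -> fejer N w = 0.
Proof.
move=> N0; rewrite in_itv/= -ler_norml -ltNge => Nw.
by apply/max_idPl; rewrite subr_le0 ler_pdivlMr// mul1r ltW.
Qed.

Lemma fejer_in N w : 0 < N -> w \in `[- N, N]%R -> fejer N w = 1 - `|w| / N.
Proof.
move=> N0; rewrite in_itv/= -ler_norml => Nw.
by apply/max_idPr; rewrite subr_ge0 ler_pdivrMr// mul1r.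
Qed.

Lemma fejer_restrict N (g : R -> R) : 0 < N ->
  (fun w => fejer N w * g w) = (fun w => fejer N w * g w) \_ `[- N, N].
Proof.
move=> N0; apply/funext => w; rewrite patchE; case: ifPn => //.
by rewrite mem_setE => /(fejer_out N0) ->; rewrite mul0r.
Qed.

Lemma integrable_fejer N (g : R -> R) : 0 < N -> continuous g ->
  mu.-integrable setT (EFin \o (fun w => fejer N w * g w)).
Proof.
move=> N0 cg; rewrite fejer_restrict// -restrict_EFin.
apply/integrable_restrict => //; rewrite setTI.
apply: (@continuous_compact_integrable R); first exact: segment_compact.
apply: continuous_subspaceT => w; apply: cvgM; [exact: continuous_fejer|exact: cg].
Qed.

(** This is the Fejer kernel. The absolute value is resolved by splitting at 0; the antiderivatives
    F1 and F2 come from integration by parts. *)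
Lemma fejer_cos N v : 0 < N -> 0 < v ->
  \int[mu]_w (fejer N w * cos (w * v)) = 2 * (1 - cos (N * v)) / (N * v ^+ 2).
Proof.
move=> N0 v0.
have c_cos : continuous (fun w : R => cos (w * v)).
  exact: (is_derive_continuous (is_derive_cos_mulr v)).
have N0' : N != 0 by rewrite gt_eqF.
have v0' : v != 0 by rewrite gt_eqF.
rewrite fejer_restrict// -Rintegral_mkcond.
have iF : mu.-integrable `[- N, N] (EFin \o (fun w => fejer N w * cos (w * v))).
  by apply: integrableS (integrable_fejer N0 c_cos).
have := @Rintegral_itvB R (fun w => fejer N w * cos (w * v)) (BLeft (- N)) (BRight N) 0 iF.
rewrite !bnd_simp (ltW N0) oppr_le0 (ltW N0) => /(_ isT isT)/eqP.
rewrite subr_eq => /eqP ->.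
rewrite Rintegral_itv_obnd_cbnd; last first.
  by apply: integrableS iF => //; apply: subset_itv => //; rewrite bnd_simp oppr_le0 ltW.
pose f1 w := (1 - N^-1 * w) * cos (w * v).
pose F1 w := (1 - N^-1 * w) * (v^-1 * sin (w * v)) - (N * v ^+ 2)^-1 * cos (w * v).
pose f2 w := (1 - - N^-1 * w) * cos (w * v).
pose F2 w := (1 - - N^-1 * w) * (v^-1 * sin (w * v)) + (N * v ^+ 2)^-1 * cos (w * v).
have d1 (c w : R) : is_derive w 1 (fun w : R => 1 - c * w) (- c).
  have := is_deriveB (is_derive_cst (1 : R) w 1) (is_derive_mull c w).
  by rewrite sub0r.
have cs w := is_derive_sin_mulr v w; have cc w := is_derive_cos_mulr v w.
have dF1 w : is_derive w 1 F1 (f1 w).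
  have ? := d1 N^-1 w.
  rewrite /F1; apply: is_derive_eq; rewrite /f1 -![_ *: _]/(_ * _); field.
  by rewrite N0'.
have dF2 w : is_derive w 1 F2 (f2 w).
  have ? := d1 (- N^-1) w.
  rewrite /F2; apply: is_derive_eq; rewrite /f2 -![_ *: _]/(_ * _); field.
  by rewrite N0'.
have cf (c : R) : continuous (fun w : R => (1 - c * w) * cos (w * v)).
  move=> w; apply: cvgM; last exact: c_cos.
  exact: (is_derive_continuous (d1 c)).
have -> : \int[mu]_(w in `[0, N]) (fejer N w * cos (w * v)) = F1 N - F1 0.
  rewrite -(integral_is_derive N0 (cf N^-1) dF1); apply: eq_Rintegral => w.
  rewrite mem_setE in_itv/= => /andP[w0 wN]; rewrite fejer_in//.
    by rewrite ger0_norm// (mulrC N^-1).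
  by rewrite in_itv/= wN andbT (le_trans _ w0)// oppr_le0 ltW.
have -> : \int[mu]_(w in `[- N, 0]) (fejer N w * cos (w * v)) = F2 0 - F2 (- N).
  rewrite -(integral_is_derive _ (cf (- N^-1)) dF2) ?oppr_lt0//; apply: eq_Rintegral => w.
  rewrite mem_setE in_itv/= => /andP[wN w0]; rewrite fejer_in//.
    by rewrite ler0_norm// !mulNr (mulrC N^-1).
  by rewrite in_itv/= wN (le_trans w0)// ltW.
rewrite /F1 /F2 !mul0r !mulr0 sin0 cos0 (mulNr N v) cosN; field.
by rewrite v0'.
Qed.

(** The real part of e^(-i w v) / (a - i w). For v != 0 it decays only like 1 / |w| and is not
    absolutely integrable in w, whence the Fejer weight. *)
Definition resolvent_kernel a w v : R := (a * cos (w * v) + w * sin (w * v)) / (a ^+ 2 + w ^+ 2).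

Lemma sqrD_gt0 a w : 0 < a -> 0 < a ^+ 2 + w ^+ 2.
Proof. by move=> a0; rewrite ltr_pwDl ?exprn_gt0 ?sqr_ge0. Qed.

Lemma resolvent_kernel_le a w v : 0 < a -> `|resolvent_kernel a w v| <= 2 / a.
Proof.
move=> a0; have d0 := sqrD_gt0 w a0.
rewrite /resolvent_kernel normrM normfV (gtr0_norm d0) ler_pdivrMr//.
have h : `|a * cos (w * v) + w * sin (w * v)| <= a + `|w|.
  rewrite (le_trans (ler_normD _ _))// !normrM (gtr0_norm a0) lerD//.
    by rewrite ler_piMr ?(ltW a0)// ler_norml cos_geN1 cos_le1.
  by rewrite ler_piMr// ler_norml sin_geN1 sin_le1.
rewrite (le_trans h)// mulrAC ler_pdivlMr// -(real_normK (num_real w)).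
have : 0 <= (a - `|w|) ^+ 2 by exact: sqr_ge0.
by have : 0 <= `|w| by []; rewrite !expr2; nra.
Qed.

Lemma continuous_resolvent_kernel a v : 0 < a ->
  continuous (fun w => resolvent_kernel a w v).
Proof.
move=> a0 w; apply: cvgM.
  apply: cvgD; first by apply: cvgMr; exact: (is_derive_continuous (is_derive_cos_mulr v)).
  by apply: cvgM; [exact: cvg_id|exact: (is_derive_continuous (is_derive_sin_mulr v))].
apply: cvgV; first by rewrite gt_eqF// sqrD_gt0.
by apply: cvgD; [exact: cvg_cst|exact: exprn_continuous].
Qed.

Definition fejer_resolvent a N v : R := \int[mu]_w (fejer N w * resolvent_kernel a w v).

(* The resolvent kernel k(v) satisfies (e^(a v) k)' = e^(a v) cos (w v). *)
Lemma fejer_resolvent_derive a N v : 0 < a -> 0 < N ->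
  is_derive v 1 (fun v => expR (a * v) * fejer_resolvent a N v)
    (expR (a * v) * \int[mu]_w (fejer N w * cos (w * v))).
Proof.
move=> a0 N0.
pose f x w := fejer N w * (expR (a * x) * resolvent_kernel a w x).
have df x w : is_derive x 1 (f ^~ w) (fejer N w * (expR (a * x) * cos (w * x))).
  have ? := is_derive_expR_mull a x.
  have ? := is_derive_sin_mull w x.
  have ? := is_derive_cos_mull w x.
  have -> : f ^~ w = fun x => fejer N w * (expR (a * x) *
      ((a ^+ 2 + w ^+ 2)^-1 * (a * cos (w * x) + w * sin (w * x)))).
    by apply/funext => z; rewrite /f /resolvent_kernel; congr (_ * (_ * _)); rewrite mulrC.
  apply: is_derive_eq; rewrite -![_ *: _]/(_ * _); field.
  by rewrite gt_eqF// sqrD_gt0.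
have int_f x : mu.-integrable setT (EFin \o f x).
  apply: integrable_fejer => // w; apply: cvgMr; exact: continuous_resolvent_kernel.
have fE : (fun v => expR (a * v) * fejer_resolvent a N v) = fun v => \int[mu]_w f v w.
  apply/funext => x; rewrite /fejer_resolvent -RintegralZl//.
    by apply: eq_Rintegral => w _; rewrite /f mulrCA.
  by apply: integrable_fejer => // w; exact: continuous_resolvent_kernel.
(* A majorant of the derivative in x that is valid on all of ]v - 1, v + 1[, as differentiation
   under the integral requires. *)
pose G w := fejer N w * expR (a * (v + 1)).
have G0 w : 0 <= G w by rewrite mulr_ge0 ?fejer_ge0 ?expR_ge0.
have iG : mu.-integrable setT (EFin \o G).
  by apply: integrable_fejer => // w; exact: cvg_cst.
have d1f x w : partial1of2 f x w = fejer N w * (expR (a * x) * cos (w * x)).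
  by rewrite /partial1of2 derive1E; apply: (@derive_val _ _ _ _ _ _ _ (df x w)).
have Iv : `]v - 1, v + 1[%classic v by rewrite /= in_itv/=; apply/andP; split; lra.
have bG x w : `]v - 1, v + 1[%classic x -> setT w -> `|partial1of2 f x w| <= G w.
  rewrite /= in_itv/= => /andP[_ xv] _; rewrite d1f normrM ger0_norm ?fejer_ge0//.
  rewrite ler_wpM2l ?fejer_ge0// normrM ger0_norm ?expR_ge0//.
  rewrite (le_trans (ler_piMr _ _)) ?expR_ge0//.
    by rewrite ler_norml cos_geN1 cos_le1.
  by rewrite ler_expR ler_pM2l// ltW.
rewrite fE; apply: DeriveDef.
  apply: (@derivable_under_integral _ _ _ mu f setT measurableT v (v - 1) (v + 1) Iv _ _ G) => //.
rewrite -derive1E (@differentiation_under_integral _ _ _ mu f setT measurableT v (v - 1) (v + 1) Iv _ _ G) //.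
rewrite -RintegralZl//.
  by apply: eq_Rintegral => w _; rewrite d1f mulrCA.
by apply: integrable_fejer => //; exact: (is_derive_continuous (is_derive_cos_mulr v)).
Qed.

End Fejer.

(** * Delay estimates for the Fejer means and their limit as N grows *)

Section FejerLimits.
Context {R : realType}.
Local Notation Rm := (measurableTypeR R).
Local Notation mu := (@lebesgue_measure R).
Implicit Types (a N v w x t : R) (f : R -> R).

Lemma one_sub_cos_le x : 1 - cos x <= x ^+ 2.
Proof.
have sin_le (y : R) : `|sin y| <= `|y|.
  have dsin (z : R) : `|z| < `|y| + 1 -> is_derive z 1 (@sin R) (cos z) by move=> _; exact: is_derive_sin.
  have := @vanishing_primitive _ 0 sin cos 1 (`|y| + 1) dsin _ ler01 y.
  rewrite sin0 subr0 mul1r expr1; apply; last by rewrite ltrDl.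
  by move=> z _; rewrite expr0 mul1r ler_norml cos_geN1 cos_le1.
have dcos (z : R) : `|z| < `|x| + 1 -> is_derive z 1 (@cos R) (- sin z) by move=> _; exact: is_derive_cos.
have := @vanishing_primitive _ 1 cos (fun z => - sin z) 1 (`|x| + 1) dcos _ ler01 x.
rewrite cos0 mul1r real_normK ?num_real// => h.
have : `|cos x - 1| <= x ^+ 2.
  by apply: h; [move=> z _; rewrite normrN mul1r expr1|rewrite ltrDl].
by rewrite distrC => /(le_trans (ler_norm _)).
Qed.

(** The first upper bound decays in N for fixed v; the second stays finite as v tends to 0 and has
    an arctangent as primitive. Its 6 is 2 + 4: with y = (N v)^2, expand 2 (1 - cos) (1 + y) and use
    1 - cos <= y in the first term, 1 - cos <= 2 in the second. *)
Lemma fejer_cos_bounds N v : 0 < N -> 0 < v ->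
  let F := \int[mu]_w (fejer N w * cos (w * v)) in
  [/\ 0 <= F, F <= 4 / (N * v ^+ 2) & F <= 6 * (N / (1 + (N * v) ^+ 2))].
Proof.
move=> N0 v0 /=; rewrite fejer_cos//.
have Nv : 0 < N * v ^+ 2 by rewrite mulr_gt0// exprn_gt0.
have := cos_geN1 (N * v); have := cos_le1 (N * v); have := one_sub_cos_le (N * v).
move: (cos _) => c c1 c2 c3; split.
- by rewrite divr_ge0 ?(ltW Nv)// mulr_ge0// subr_ge0.
- by rewrite ler_pM2r ?invr_gt0//; lra.
- have d0 : 0 < 1 + (N * v) ^+ 2 by rewrite ltr_pwDl// sqr_ge0.
  rewrite ler_pdivrMr//.
  have -> : 6 * (N / (1 + (N * v) ^+ 2)) * (N * v ^+ 2) =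
     6 * (N * v) ^+ 2 / (1 + (N * v) ^+ 2) by field; rewrite gt_eqF.
  rewrite ler_pdivlMr//; move: ((N * v) ^+ 2) (sqr_ge0 (N * v)) c1 => y y0 c1.
  by nra.
Qed.

Lemma continuous_fejer_resolvent a N : 0 < a -> 0 < N -> continuous (fejer_resolvent a N).
Proof.
move=> a0 N0.
have -> : fejer_resolvent a N =
    fun v => expR (- a * v) * (expR (a * v) * fejer_resolvent a N v).
  by apply/funext => v; rewrite mulrA -expRD mulNr addNr expR0 mul1r.
move=> v; apply: cvgM.
  exact: (is_derive_continuous (is_derive_expR_mull (- a))).
exact: (is_derive_continuous (fun v => fejer_resolvent_derive v a0 N0)).
Qed.

(** With M(v) = e^(a v) k(v), delta equals (M(t + tau) - M(t)) / e^(a (t + tau)), that is, the Fejer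
    kernel integrated over [t, t + tau] against weights at most 1. The first upper bound gives
    convergence to 0 for each t > 0, the second a bound uniform in N and t for dominated
    convergence. *)
Lemma fejer_resolvent_delay a N t tau : 0 < a -> 0 < N -> 0 < t -> 0 <= tau ->
  let delta := fejer_resolvent a N (t + tau) - expR (- (a * tau)) * fejer_resolvent a N t in
  [/\ 0 <= delta, delta <= 4 * tau / (N * t ^+ 2) &
      delta <= 6 * (atan (N * (t + tau)) - atan (N * t))].
Proof.
move=> a0 N0 t0 tau0 delta.
have ttau : t <= t + tau by rewrite lerDl.
pose M v := expR (a * v) * fejer_resolvent a N v.
pose F v := \int[mu]_w (fejer N w * cos (w * v)).
have dM v : is_derive v 1 M (expR (a * v) * F v) by exact: fejer_resolvent_derive.
have cM := is_derive_continuous dM.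
have FB v : t <= v -> [/\ 0 <= F v, F v <= 4 / (N * v ^+ 2) &
    F v <= 6 * (N / (1 + (N * v) ^+ 2))].
  by move=> tv; apply: fejer_cos_bounds => //; exact: lt_le_trans tv.
have E0 := expR_gt0 (a * (t + tau)).
have deltaE : delta = (M (t + tau) - M t) / expR (a * (t + tau)).
  rewrite /M mulrBl mulrAC divff ?gt_eqF// mul1r mulrAC -expRN -expRD.
  by rewrite /delta; congr (_ - expR _ * _); ring.
have eE c : c \in `[t, t + tau] -> expR (a * c) <= expR (a * (t + tau)).
  by rewrite in_itv/= => /andP[_ ct]; rewrite ler_expR ler_pM2l.
have [c ct Mc] : exists2 c, c \in `[t, t + tau] & M (t + tau) - M t = expR (a * c) * F c * tau.
  have [c ct] := MVT_segment ttau (fun z _ => dM z) (continuous_subspaceT cM).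
  by rewrite addrAC subrr add0r; exists c.
have tc : t <= c by move: ct; rewrite in_itv/= => /andP[].
have [F0 F4 _] := FB c tc.
split.
- by rewrite deltaE Mc divr_ge0 ?expR_ge0// !mulr_ge0// expR_ge0.
- rewrite deltaE Mc ler_pdivrMr// mulrAC.
  have h : F c <= 4 / (N * t ^+ 2).
    have c0 : 0 < c by exact: lt_le_trans tc.
    rewrite (le_trans F4)// ler_wpM2l// lef_pV2 ?posrE ?mulr_gt0 ?exprn_gt0//.
    by rewrite ler_pM2l// lerXn2r// nnegrE ltW.
  have := ler_pM (expR_ge0 _) F0 (eE _ ct) h => h2.
  rewrite mulrAC (le_trans (ler_wpM2r tau0 h2))//.
  by rewrite le_eqVlt; apply/orP; left; apply/eqP; ring.
(* Rather than integrating the bound on F, compare derivatives: that of P is nonnegative on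
   [t, t + tau], so P t <= P (t + tau). *)
- pose P v := 6 * expR (a * (t + tau)) * atan (N * v) - M v.
  have datan v : is_derive v 1 (fun v => atan (N * v)) ((1 + (N * v) ^+ 2)^-1 * N).
    have -> : (fun v => atan (N * v)) = atan \o (fun v => N * v) by [].
    by apply: is_derive1_comp; exact: is_derive_mull.
  have dP v : is_derive v 1 P
      (6 * expR (a * (t + tau)) * ((1 + (N * v) ^+ 2)^-1 * N) - expR (a * v) * F v).
    have ? := datan v; have ? := dM v.
    have -> : P = (6 * expR (a * (t + tau))) *: (fun v => atan (N * v)) - M by [].
    by apply: is_deriveB.
  have [c' ct' Pc] := MVT_segment ttau (fun z _ => dP z) (continuous_subspaceT (is_derive_continuous dP)).
  have tc' : t <= c' by move: ct'; rewrite in_itv/= => /andP[].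
  have [F0' _ F6] := FB c' tc'.
  have : 0 <= P (t + tau) - P t.
    rewrite Pc mulr_ge0// ?subr_ge0//.
    rewrite (le_trans (ler_pM (expR_ge0 _) F0' (eE _ ct') F6))//.
    by rewrite le_eqVlt; apply/orP; left; apply/eqP; rewrite (mulrC N); ring.
  rewrite deltaE ler_pdivrMr// /P => h.
  rewrite -subr_ge0 (le_trans h)// le_eqVlt; apply/orP; left; apply/eqP.
  by move: (atan _) (atan _) (M _) (M _) (expR _) => *; ring.
Qed.

(** This bound grows with N and serves only to make f times the kernel integrable for each N;
    uniformity in N is available for the delay error alone. *)
Lemma fejer_resolvent_le a N v : 0 < a -> 0 < N ->
  `|fejer_resolvent a N v| <= 2 / a * \int[mu]_w fejer N w.
Proof.
move=> a0 N0.
have iF : mu.-integrable setT (EFin \o fejer N).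
  have c1 : continuous (cst 1 : R -> R) by move=> ?; exact: cvg_cst.
  have := integrable_fejer N0 c1.
  by under [X in integrable _ _ X]eq_fun do rewrite /= mulr1.
have iK := integrable_fejer N0 (continuous_resolvent_kernel (v := v) a0).
rewrite /fejer_resolvent (le_trans (le_normr_Rintegral measurableT iK))//.
rewrite -RintegralZl//; apply: le_Rintegral => //.
- exact: (integrable_normr iK).
- exact: (integrable_mull measurableT _ iF).
- move=> w _; rewrite normrM ger0_norm ?fejer_ge0// mulrC ler_wpM2r ?fejer_ge0//.
  exact: resolvent_kernel_le.
Qed.

Lemma Rintegral_Fubini (g : R -> R -> R) :
    (mu \x mu)%E.-integrable setT (fun z : Rm * Rm => (g z.1 z.2)%:E) ->
    (forall x, mu.-integrable setT (EFin \o g x)) ->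
    (forall y, mu.-integrable setT (EFin \o g ^~ y)) ->
  \int[mu]_x \int[mu]_y g x y = \int[mu]_y \int[mu]_x g x y.
Proof.
move=> ig i1 i2; rewrite {1 3}/Rintegral; congr fine.
under eq_integral => x _ do rewrite fineK ?(integrable_fin_num measurableT (i1 x))//.
under [RHS]eq_integral => y _ do rewrite fineK ?(integrable_fin_num measurableT (i2 y))//.
exact: (Fubini ig).
Qed.

(** The double integrand is dominated by the weight times (2 / a) |f(t)|, which is integrable on the
    plane because the weight has compact support. *)
Lemma fejer_resolvent_Fubini f a N : 0 < a -> 0 < N ->
    mu.-integrable setT (EFin \o f) ->
  \int[mu]_w (fejer N w * \int[mu]_t (f t * resolvent_kernel a w t)) =
  \int[mu]_t (f t * fejer_resolvent a N t).
Proof.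
move=> a0 N0 iF.
have mf : measurable_fun (setT : set Rm) f.
  by apply/measurable_EFinP; exact: (measurable_int mu iF).
have mc (h : R -> R) : continuous h -> measurable_fun (setT : set Rm) h.
  by move=> ch; exact: (continuous_measurable_fun ch).
have ifk w : mu.-integrable setT (EFin \o (fun t => f t * resolvent_kernel a w t)).
  apply: (integrable_le measurableT _ _ (integrable_mull measurableT (2 / a) (integrable_normr iF))).
    apply: measurable_funM => //; apply: mc => t.
    apply: cvgMl; apply: cvgD; apply: cvgMr.
      exact: (is_derive_continuous (is_derive_cos_mull w)).
    exact: (is_derive_continuous (is_derive_sin_mull w)).
  by move=> t _; rewrite normrM mulrC ler_wpM2r// resolvent_kernel_le.
pose g w t := fejer N w * (f t * resolvent_kernel a w t).
have i1 w : mu.-integrable setT (EFin \o g w) by exact: (integrable_mull measurableT).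
have i2 t : mu.-integrable setT (EFin \o g ^~ t).
  apply: (integrable_fejer N0) => w; apply: cvgMr; exact: continuous_resolvent_kernel.
have mg : measurable_fun setT (fun z : Rm * Rm => g z.1 z.2).
  have m1 (h : R -> R) : continuous h -> measurable_fun setT (fun z : Rm * Rm => h z.1).
    by move=> ch; apply: (measurableT_comp (mc _ ch)); exact: measurable_fst.
  have m12 (h : R -> R) : continuous h -> measurable_fun setT (fun z : Rm * Rm => h (z.1 * z.2)).
    move=> ch; apply: (measurableT_comp (continuous_measurable_fun ch)).
    apply: measurable_funM; first exact: measurable_fst.
    exact: measurable_snd.
  apply: measurable_funM; first by apply: m1; exact: continuous_fejer.
  apply: measurable_funM; first by apply: (measurableT_comp mf); exact: measurable_snd.
  apply: measurable_funM; last first.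
    apply: (m1 (fun w => (a ^+ 2 + w ^+ 2)^-1)) => w.
    apply: cvgV; first by rewrite gt_eqF// sqrD_gt0.
    by apply: cvgD; [exact: cvg_cst|exact: exprn_continuous].
  apply: measurable_funD; apply: measurable_funM.
  - exact: measurable_cst.
  - by apply: m12; exact: continuous_cos.
  - by apply: (m1 id) => w; exact: cvg_id.
  - by apply: m12; exact: continuous_sin.
transitivity (\int[mu]_w \int[mu]_t g w t).
  by apply: eq_Rintegral => w _; rewrite /g RintegralZl.
rewrite Rintegral_Fubini//.
  apply: eq_Rintegral => t _; rewrite /fejer_resolvent -RintegralZl//.
    by apply: eq_Rintegral => w _; rewrite /g mulrCA.
  by apply: integrable_fejer => //; exact: continuous_resolvent_kernel.
apply/integrable12ltyP; first exact/measurable_EFinP.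
have -> : (fun w : Rm => \int[mu]_t `|(g w t)%:E|)%E =
    EFin \o (fun w => fejer N w * \int[mu]_t `|f t * resolvent_kernel a w t|).
  apply/funext => w; rewrite /= -RintegralZl//; last exact: (integrable_normr (ifk w)).
  rewrite /Rintegral fineK.
    by apply: eq_integral => t _; rewrite /= /g (normrM (fejer N w)) (ger0_norm (fejer_ge0 _ _)).
  apply: (integrable_fin_num measurableT).
  exact: (integrable_mull measurableT _ (integrable_normr (ifk w))).
apply: (integrable_lty measurableT).
have K0 : 0 <= 2 / a * \int[mu]_t `|f t|.
  by rewrite mulr_ge0 ?divr_ge0 ?(ltW a0)//; exact: Rintegral_ge0.
have iK : mu.-integrable setT (EFin \o (fun w => fejer N w * (2 / a * \int[mu]_t `|f t|))).
  by apply: integrable_fejer => // w; exact: cvg_cst.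
apply: (integrable_le measurableT _ _ iK).
  apply/measurable_EFinP.
  have -> : EFin \o (fun w : Rm => fejer N w * \int[mu]_t `|f t * resolvent_kernel a w t|) =
      fun w : Rm => (\int[mu]_t `|(g w t)%:E|)%E.
    apply/funext => w; rewrite /= -RintegralZl//; last exact: (integrable_normr (ifk w)).
    rewrite /Rintegral fineK.
      by apply: eq_integral => t _; rewrite /= /g (normrM (fejer N w)) (ger0_norm (fejer_ge0 _ _)).
    apply: (integrable_fin_num measurableT).
    exact: (integrable_mull measurableT _ (integrable_normr (ifk w))).
  apply: (@measurable_fun_fubini_tonelli_F _ _ Rm Rm R mu (fun z => `|(g z.1 z.2)%:E|)%E).
    by apply: measurableT_comp => //; exact/measurable_EFinP.
  by move=> z; exact: abse_ge0.
move=> w _; rewrite normrM (ger0_norm (fejer_ge0 _ _)) ler_wpM2l ?fejer_ge0//.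
rewrite ger0_norm; last exact: Rintegral_ge0.
rewrite -RintegralZl//; last exact: (integrable_normr iF).
apply: le_Rintegral => //.
- exact: (integrable_normr (ifk w)).
- exact: (integrable_mull measurableT _ (integrable_normr iF)).
- by move=> t _; rewrite normrM mulrC ler_wpM2r// resolvent_kernel_le.
Qed.

Lemma fejer_cvg1 w : fejer n.+1%:R w @[n --> \oo] --> (1 : R).
Proof.
apply: (@squeeze_cvgr _ _ _ _ (fun n => 1 - `|w| * n.+1%:R^-1) (fun=> 1)).
- near=> n; rewrite fejer_le1// andbT le_max; apply/orP; by right.
- rewrite -[X in _ --> X]subr0; apply: cvgB; first exact: cvg_cst.
  rewrite -[X in _ --> X](mulr0 `|w|); apply: cvgMr; exact: cvg_harmonic.
- exact: cvg_cst.
Unshelve. all: by end_near. Qed.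

Lemma fejer_integral_cvg (S : R -> R) : mu.-integrable setT (EFin \o S) ->
  \int[mu]_w (fejer n.+1%:R w * S w) @[n --> \oo] --> \int[mu]_w S w.
Proof.
move=> iS.
have mS : measurable_fun (setT : set Rm) S.
  by apply/measurable_EFinP; exact: (measurable_int mu iS).
have mfS n : measurable_fun (setT : set Rm) (fun w => (fejer n.+1%:R w * S w)%:E).
  apply/measurable_EFinP; apply: measurable_funM => //.
  exact: (continuous_measurable_fun (@continuous_fejer R n.+1%:R)).
have cvS : {ae mu, forall w, setT w -> (fejer n.+1%:R w * S w)%:E @[n --> \oo] --> (EFin \o S) w}.
  apply: aeW => w _; apply: cvg_EFin; first exact: nearW.
  by rewrite -[X in _ --> X]mul1r; apply: cvgMl; exact: fejer_cvg1.
have bS : {ae mu, forall w n, setT w -> (`|(fejer n.+1%:R w * S w)%:E| <= (EFin \o (fun w => `|S w|)%R) w)%E}.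
  apply: aeW => w n _.
  by rewrite /= lee_fin normrM ger0_norm ?fejer_ge0// ler_piMl// fejer_le1.
have [_ _ h] := dominated_convergence measurableT mfS (measurable_int mu iS) cvS (integrable_normr iS) bS.
apply: fine_cvg; rewrite fineK ?(integrable_fin_num measurableT iS)//; exact: h.
Qed.

End FejerLimits.

(** * Delays and the resolvent transform *)

Section Shift.
Context {R : realType}.
Local Notation Rm := (measurableTypeR R).
Local Notation mu := (@lebesgue_measure R).

(** The translation is named so that a measurable-function structure can be attached to it, which
    makes the pushforward below a measure. *)
Definition shift_by (c : R) : Rm -> Rm := fun t => t - c.

Lemma measurable_shift_by c : measurable_fun (setT : set Rm) (shift_by c).
Proof.
apply: (continuous_measurable_fun (f := fun t : R => t - c)) => t.
by apply: cvgB; [exact: cvg_id|exact: cvg_cst].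
Qed.

HB.instance Definition _ c :=
  isMeasurableFun.Build _ _ Rm Rm (shift_by c) (measurable_shift_by c).

(** Uniqueness of Lebesgue measure reduces the claim to half-open intervals. *)
Lemma lebesgue_measure_shift (c : R) (A : set Rm) : measurable A ->
  pushforward mu (shift_by c) A = mu A.
Proof.
move=> mA; apply/esym; apply: (@lebesgue_measure_unique R (pushforward mu (shift_by c))) => //.
move=> _ [[x y] _ <-] /=; rewrite /pushforward.
have -> : shift_by c @^-1` `]x, y] = `]x + c, y + c]%classic.
  by apply/seteqP; split => t /=; rewrite /shift_by !in_itv/= ltrBrDr lerBlDr.
rewrite !lebesgue_measure_itv/= !lte_fin ltrD2r; case: ifPn => // xy.
by rewrite -!EFinD; congr EFin; ring.
Qed.

Lemma ge0_integral_shift (c : R) (f : R -> \bar R) : measurable_fun (setT : set Rm) f ->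
  (forall x, 0 <= f x)%E ->
  (\int[mu]_t f (t - c)%R = \int[mu]_t f t)%E.
Proof.
move=> mf f0.
rewrite -[LHS](ge0_integral_pushforward (measurable_shift_by c) mu measurableT mf)//.
by apply: eq_measure_integral => A mA _; exact: lebesgue_measure_shift.
Qed.

Lemma measurable_fun_shift (c : R) (f : R -> R) : measurable_fun (setT : set Rm) f ->
  measurable_fun (setT : set Rm) (fun t => f (t - c)).
Proof. by move=> mf; apply: (measurableT_comp mf (measurable_shift_by c)). Qed.

Lemma integrable_shift (c : R) (f : R -> R) : mu.-integrable setT (EFin \o f) ->
  mu.-integrable setT (EFin \o (fun t => f (t - c))).
Proof.
move=> /integrableP[/measurable_EFinP mf foo]; apply/integrableP; split.
  by apply/measurable_EFinP; exact: measurable_fun_shift.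
rewrite [X in (X < _)%E](ge0_integral_shift c (f := fun t => `|(f t)%:E|%E))//.
by apply: measurableT_comp => //; exact/measurable_EFinP.
Qed.

Lemma Rintegral_shift (c : R) (f : R -> R) : mu.-integrable setT (EFin \o f) ->
  \int[mu]_t f (t - c) = \int[mu]_t f t.
Proof.
move=> iF; have ifc := integrable_shift c iF; congr fine.
rewrite -[LHS](integral_pushforward (measurable_shift_by c) (measurable_int mu iF) ifc measurableT).
by apply: eq_measure_integral => A mA _; exact: lebesgue_measure_shift.
Qed.

End Shift.

Section ResolventDelay.
Context {R : realType}.
Local Notation Rm := (measurableTypeR R).
Local Notation mu := (@lebesgue_measure R).
Implicit Types (a t : R) (f : R -> R).

Definition resolvent_transform a f w : R := \int[mu]_t (f t * resolvent_kernel a w t).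

Lemma integrable_mul_bounded f (k : R -> R) (C : R) : mu.-integrable setT (EFin \o f) ->
    continuous k -> (forall t, `|k t| <= C) ->
  mu.-integrable setT (EFin \o (fun t => f t * k t)).
Proof.
move=> iF ck kC.
have mf : measurable_fun (setT : set Rm) f.
  by apply/measurable_EFinP; exact: (measurable_int mu iF).
apply: (integrable_le measurableT _ _ (integrable_mull measurableT C (integrable_normr iF))).
  by apply: measurable_funM => //; exact: (continuous_measurable_fun ck).
by move=> t _; rewrite normrM mulrC ler_wpM2r.
Qed.

(* The Fejer means of the resolvent kernel satisfy k(t + tau) = e^(-a tau) k(t)
   up to an error that is bounded and vanishes in the limit for each t > 0. *)
Lemma resolvent_transform_delay a tau f : 0 < a -> 0 <= tau ->
    mu.-integrable setT (EFin \o f) -> (forall t, t < 0 -> f t = 0) ->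
    mu.-integrable setT (EFin \o resolvent_transform a f) ->
    mu.-integrable setT (EFin \o resolvent_transform a (fun t => f (t - tau))) ->
  \int[mu]_w resolvent_transform a (fun t => f (t - tau)) w =
  expR (- (a * tau)) * \int[mu]_w resolvent_transform a f w.
Proof.
move=> a0 tau0 iF f0 iS iSd.
have ifd := integrable_shift tau iF.
have mf : measurable_fun (setT : set Rm) f.
  by apply/measurable_EFinP; exact: (measurable_int mu iF).
have Nn n : 0 < n.+1%:R :> R by rewrite ltr0n.
pose k n := fejer_resolvent a n.+1%:R.
have ck n : continuous (k n) by exact: continuous_fejer_resolvent.
have kC n t : `|k n t| <= 2 / a * \int[mu]_w fejer n.+1%:R w by exact: fejer_resolvent_le.
have ckd n : continuous (fun t => k n (t + tau)).
  move=> t; apply: (continuous_comp (f := fun t => t + tau)); last exact: ck.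
  by apply: cvgD; [exact: cvg_id|exact: cvg_cst].
have ifk n := integrable_mul_bounded iF (ck n) (kC n).
have ifkd n := integrable_mul_bounded iF (ckd n) (fun t => kC n (t + tau)).
(* The Fejer means of the transform converge to its full integral because the transform is
   integrable; Fubini turns them into integrals of f against k n. *)
have lim1 : \int[mu]_t (f t * k n t) @[n --> \oo] --> \int[mu]_w resolvent_transform a f w.
  have := fejer_integral_cvg iS; apply: cvg_trans; apply: near_eq_cvg; near=> n.
  by rewrite -(fejer_resolvent_Fubini a0 (Nn n) iF).
(* As before, with a translation in t that moves the delay from f to the kernel. *)
have lim2 : \int[mu]_t (f t * k n (t + tau)) @[n --> \oo] -->
    \int[mu]_w resolvent_transform a (fun t => f (t - tau)) w.
  have := fejer_integral_cvg iSd; apply: cvg_trans; apply: near_eq_cvg; near=> n.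
  rewrite /resolvent_transform (fejer_resolvent_Fubini a0 (Nn n) ifd).
  rewrite -(Rintegral_shift tau (ifkd n)); apply: eq_Rintegral => t _.
  by rewrite subrK.
(* The estimates for delta hold for t > 0 only. Restricting to this half-line loses nothing: f
   vanishes for t < 0, and the point 0 is null. *)
pose D : set Rm := `]0, +oo[%classic.
have mD : measurable D by exact: measurable_itv.
pose delta n t := k n (t + tau) - expR (- (a * tau)) * k n t.
have cd n : continuous (delta n).
  move=> t; apply: cvgB; first exact: ckd.
  by apply: cvgMr; exact: ck.
have ifdel n : mu.-integrable setT (EFin \o (fun t => f t * delta n t)).
  have -> : (fun t => f t * delta n t) =
      fun t => f t * k n (t + tau) - expR (- (a * tau)) * (f t * k n t).
    by apply/funext => t; rewrite /delta; ring.
  by apply: integrable_sub => //; exact: integrable_mull.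
have dE n : \int[mu]_(t in D) (f t * delta n t) =
    \int[mu]_t (f t * k n (t + tau)) - expR (- (a * tau)) * \int[mu]_t (f t * k n t).
  rewrite -RintegralZl// -RintegralB//; last exact: integrable_mull.
  rewrite Rintegral_itv_obnd_cbnd; last by apply: integrableS (ifdel n).
  rewrite Rintegral_mkcond; apply: eq_Rintegral => t _; rewrite patchE.
  case: ifPn => [_|]; first by rewrite /delta; ring.
  rewrite mem_setE in_itv/= andbT -ltNge => /f0 ->.
  by rewrite !mul0r mulr0 subr0.
have lim0 : \int[mu]_(t in D) (f t * delta n t) @[n --> \oo] --> (0 : R).
  have mfd n : measurable_fun D (fun t => (f t * delta n t)%:E).
    by apply: (measurable_funS measurableT) => //; exact: (measurable_int mu (ifdel n)).
  (* A difference of two arctangents is at most pi. *)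
  have db n t : 0 < t -> `|delta n t| <= 6 * pi.
    move=> t0; have [d0 _ d6] := fejer_resolvent_delay a0 (Nn n) t0 tau0.
    rewrite ger0_norm// (le_trans d6)//.
    have := atan_ltpi2 (n.+1%:R * (t + tau)); have := atan_gtNpi2 (n.+1%:R * t).
    by move: (atan _) (atan _) => x y ? ?; rewrite ler_pM2l//; lra.
  have cv0 : {ae mu, forall t, D t -> (f t * delta n t)%:E @[n --> \oo] --> (cst 0 : Rm -> \bar R) t}.
    apply: aeW => t; rewrite /D/= in_itv/= andbT => t0.
    apply: cvg_EFin; first exact: nearW.
    rewrite -[X in _ --> X](mulr0 (f t)); apply: cvgMr.
    apply: (@squeeze_cvgr _ _ _ _ (fun=> 0) (fun n => 4 * tau / t ^+ 2 * n.+1%:R^-1)).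
    - near=> n; have [-> /= d4 _] := fejer_resolvent_delay a0 (Nn n) t0 tau0.
      rewrite (le_trans d4)// le_eqVlt; apply/orP; left; apply/eqP; field.
      by rewrite nat1r pnatr_eq0 (gt_eqF t0).
    - exact: cvg_cst.
    - rewrite -[X in _ --> X](mulr0 (4 * tau / t ^+ 2)); apply: cvgMr; exact: cvg_harmonic.
  have ig : mu.-integrable D (EFin \o (fun t => 6 * pi * `|f t|)).
    by apply: integrableS (integrable_mull measurableT _ (integrable_normr iF)).
  have bd : {ae mu, forall t n, D t -> (`|(f t * delta n t)%:E| <= (EFin \o (fun t => 6 * pi * `|f t|)%R) t)%E}.
    apply: aeW => t n; rewrite /D/= in_itv/= andbT => t0.
    by rewrite lee_fin normrM mulrC ler_wpM2r// db.
  have [_ _] := dominated_convergence mD mfd (measurable_cst _) cv0 ig bd.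
  rewrite integral_cst// mul0e => h.
  by apply: fine_cvg; exact: h.
have lim3 : \int[mu]_(t in D) (f t * delta n t) @[n --> \oo] -->
    \int[mu]_w resolvent_transform a (fun t => f (t - tau)) w -
    expR (- (a * tau)) * \int[mu]_w resolvent_transform a f w.
  under eq_cvg do rewrite dE.
  by apply: cvgB => //; apply: cvgMr.
by apply/eqP; rewrite -subr_eq0; apply/eqP; exact: (cvg_unique _ lim3 lim0).
Unshelve. all: by end_near. Qed.

End ResolventDelay.

(** * Continuous time *)

Section MarkovOfPairings.
Context {R : realType}.
Local Notation normc := ComplexField.Normc.normc.

(** On the contour the j-th Laguerre function, taken at -s or 1/z with its scalar factors, is k0
    m0^j with |m0| = 1, and c normalizes the inner product. G is the inverse of the factor by which
    a delay multiplies the pairing with the summed kernel; d <= 1/2 keeps l in the range of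
    [pairing_geometric]. *)
Lemma markov_of_pairings (D : set (measurableTypeR R)) (U Y k0 m0 : R -> R[i])
    (c al rho d : R) (G G' : R -> R) (us ys : nat -> R) :
    measurable D -> square_integrable D U -> square_integrable D Y ->
    square_integrable D k0 -> cmeasurable D m0 ->
    (forall x, D x -> normc (m0 x) = 1) ->
    (forall j, us j = c * pairing D U (fun x => k0 x * m0 x ^+ j)) ->
    (forall j, ys j = c * pairing D Y (fun x => k0 x * m0 x ^+ j)) ->
    0 < d -> d <= 2^-1 ->
    (forall l : R, `|l| < d -> is_derive l 1 G (G' l)) ->
    (forall l : R, `|l| < d -> (1 + al * l + l ^+ 2) * G' l = - rho * G l) ->
    G 0 != 0 ->
    (forall l : R, `|l| < d ->
      G l * pairing D Y (fun x => k0 x / (1 - l%:C%C * m0 x)) =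
      pairing D U (fun x => k0 x / (1 - l%:C%C * m0 x))) ->
    us 0%N != 0 ->
  forall m, let h := markov_parameter us ys in
  m.+1%:R * h m.+1 + al * m%:R * h m + m.-1%:R * h m.-1 = rho * h m.
Proof.
move=> mD sU sY sk mm m1 usE ysE d0 d2 dG qG G0 GYU u0.
apply: (markov_recurrence d0 dG qG G0 u0) => n.
have [CU hU] := pairing_geometric mD sU sk mm m1.
have [CY hY] := pairing_geometric mD sY sk mm m1.
have dG0 : is_derive (0 : R) 1 G (G' 0) by apply: dG; rewrite normr0.
have [e1 e10 GB] := is_derive_bounded dG0.
exists (`|c| * ((`|G 0| + 1) * CY + CU)), (Num.min d e1).
rewrite lt_min d0 e10; split => // l; rewrite lt_min => /andP[ld le1].
have l2 : `|l| <= 2^-1 by rewrite ltW// (lt_le_trans ld).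
have := hU n l l2; have := hY n l l2; have := GYU _ ld.
set PY := pairing D Y _; set PU := pairing D U _.
set SY := \sum_(j < n) _; set SU := \sum_(j < n) _ => GE hYl hUl.
have -> : \sum_(j < n) ys j * l ^+ j = c * SY.
  by rewrite mulr_sumr; apply: eq_bigr => j _; rewrite ysE mulrA.
have -> : \sum_(j < n) us j * l ^+ j = c * SU.
  by rewrite mulr_sumr; apply: eq_bigr => j _; rewrite usE mulrA.
(* Because G PY = PU, only the two remainders of the geometric sums are left on the right. *)
have -> : G l * (c * SY) - c * SU = c * ((PU - SU) - G l * (PY - SY)).
  by rewrite -GE; ring.
rewrite normrM -mulrA ler_wpM2l// (le_trans (ler_normB _ _))// mulrDl addrC.
rewrite lerD// normrM -mulrA ler_pM// GB//.
Qed.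

End MarkovOfPairings.

(** * Laplace transforms on vertical lines and the effect of a delay *)

Section ContinuousTime.
Context {R : realType}.
Local Notation Rm := (measurableTypeR R).
Local Notation mu := (@lebesgue_measure R).
Local Notation normc := ComplexField.Normc.normc.
Implicit Types (w u f : R -> R) (W V : R[i] -> R[i]).
Local Open Scope complex_scope.

Lemma integrable_oneDsqr : mu.-integrable setT (EFin \o (fun x : R => (1 + x ^+ 2)^-1)).
Proof.
have c1 : continuous (fun x : R => (1 + x ^+ 2)^-1).
  exact: (@continuous_oneDsqrV R).
have p0 (x : R) : 0 <= (1 + x ^+ 2)^-1 by rewrite invr_ge0 addr_ge0 ?sqr_ge0.
apply/integrableP; split.
  by apply/measurable_EFinP; exact: (continuous_measurable_fun c1).
under eq_integral do rewrite /= ger0_norm//.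
rewrite ge0_symfun_integralT//; last by move=> x /=; rewrite sqrrN.
have -> : [set x : R | 0 <= x] = `[0, +oo[%classic.
  by apply/seteqP; split => x /=; rewrite in_itv/= andbT.
have := @integral0y_oneDsqr R; rewrite /oneDsqr /= => ->.
by rewrite -EFinM ltry.
Qed.

Lemma integrable_sqrD (a : R) : 0 < a ->
  mu.-integrable setT (EFin \o (fun x : R => (a ^+ 2 + x ^+ 2)^-1)).
Proof.
move=> a0; apply: (integrable_le measurableT _ _
  (integrable_mull measurableT (1 + (a ^+ 2)^-1) integrable_oneDsqr)).
  apply: (continuous_measurable_fun (f := fun x => (a ^+ 2 + x ^+ 2)^-1)) => x.
  apply: cvgV; first by rewrite gt_eqF// sqrD_gt0.
  by apply: cvgD; [exact: cvg_cst|exact: exprn_continuous].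
move=> x _; rewrite ger0_norm; last by rewrite invr_ge0 ltW// sqrD_gt0.
have x2 := sqr_ge0 x; have a2 : 0 < a ^+ 2 by rewrite exprn_gt0.
rewrite ler_pdivlMr ?ltr_pwDl// mulrC ler_pdivrMr ?sqrD_gt0//.
rewrite mulrDl mul1r mulrDr mulVf ?gt_eqF//.
have : 0 <= (a ^+ 2)^-1 * x ^+ 2 by rewrite mulr_ge0// invr_ge0 ltW.
by lra.
Qed.

(** As a function of s = i w its pole is at s = a, in the right half-plane, because the inner
    product evaluates the Laguerre functions at -s. *)
Definition resolvent (a w : R) : R[i] := (a%:C - w *i)^-1.

Lemma resolventE (a w : R) : a%:C - w *i = a +i* - w.
Proof. by apply/eqP; rewrite eq_complex /= subr0 sub0r !eqxx. Qed.

Lemma cmeasurable_resolvent (a : R) : cmeasurable (setT : set Rm) (resolvent a).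
Proof.
apply: cmeasurableV => //; split.
  by under eq_fun do rewrite resolventE; exact: measurable_cst.
under eq_fun do rewrite resolventE.
apply: (continuous_measurable_fun (f := fun x : R => - x)) => x.
by apply: cvgN; exact: cvg_id.
Qed.

Lemma square_integrable_resolvent (a : R) : 0 < a ->
  square_integrable (setT : set Rm) (resolvent a).
Proof.
move=> a0; apply/square_integrableP => //; split; first exact: cmeasurable_resolvent.
have -> : (fun x => normc (resolvent a x) ^+ 2) = fun x => (a ^+ 2 + x ^+ 2)^-1.
  apply/funext => x; rewrite ComplexField.Normc.normcV resolventE exprVn sqr_normc /=.
  by rewrite sqrrN.
exact: integrable_sqrD.
Qed.

Lemma integrable_damped w (x : R) : L2_signal w -> 0 < x ->
  mu.-integrable setT (EFin \o (fun t => w t * expR (- (x * t)))).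
Proof.
move=> [w0 wL] x0; have iw := Lfun2_integrable_sqr wL.
have x20 : 0 < 2 * x by rewrite mulr_gt0.
have mw : measurable_fun (setT : set Rm) w := set_mem (sub_Lfun_mfun wL).
(* The exponential density of rate 2 x, divided by 2 x, is e^(-2 x t) for t >= 0 and 0 for t < 0,
   and |w| e^(-x t) <= w^2 + e^(-2 x t) for t >= 0. *)
have ie := integrable_mull measurableT ((2 * x)^-1) (integrable_exponential_pdf x20).
apply: (integrable_le measurableT _ _ (integrable_add measurableT iw ie)).
  apply: measurable_funM => //.
  apply: (continuous_measurable_fun (f := fun t => expR (- (x * t)))) => t.
  under eq_fun do rewrite -mulNr.
  exact: (is_derive_continuous (is_derive_expR_mull (- x))).
move=> t _; have [t0|t0] := ltP t 0.
  by rewrite w0// mul0r normr0 expr0n/= add0r mulr_ge0 ?invr_ge0 ?(ltW x20)// exponential_pdf_ge0// ltW.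
rewrite exponential_pdfE// mulrA mulVf ?gt_eqF// mul1r.
have -> : expR (- (2 * x) * t) = expR (- (x * t)) ^+ 2.
  by rewrite expr2 -expRD; congr expR; ring.
rewrite normrM (ger0_norm (expR_ge0 _)) -(real_normK (num_real (w t))).
have := expR_ge0 (- (x * t)); have := normr_ge0 (w t).
move: (`|w t|) (expR _) => b e b0 e0.
have : 0 <= (b - e) ^+ 2 by exact: sqr_ge0.
have be : 0 <= b * e by rewrite mulr_ge0.
by rewrite !expr2; lra.
Qed.

(** What the argument on the lines Re s = x keeps of an L_2 signal; translation of integrals passes
    it on to delayed signals. *)
Definition damped_signal w : Prop := (forall t, t < 0 -> w t = 0) /\
  forall x, 0 < x -> mu.-integrable setT (EFin \o (fun t => w t * expR (- (x * t)))).

Lemma L2_damped_signal w : L2_signal w -> damped_signal w.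
Proof. by move=> wL; split=> [|x]; [exact: wL.1|exact: integrable_damped]. Qed.

Lemma delay_expR (tau x t : R) w : cdelay tau w t * expR (- (x * t)) =
  expR (- (x * tau)) * (w (t - tau) * expR (- (x * (t - tau)))).
Proof. by rewrite mulrCA -expRD; congr (_ * expR _); ring. Qed.

Lemma damped_signal_delay (tau : R) w : 0 <= tau -> damped_signal w ->
  damped_signal (cdelay tau w).
Proof.
move=> tau0 [w0 iw]; split; first by move=> t t0; apply: w0; lra.
move=> x x0; under [X in integrable _ _ X]eq_fun do rewrite /= delay_expR.
by apply: integrable_mull => //; exact: (integrable_shift tau (iw x x0)).
Qed.

Lemma integrable_damped_cos w (x o : R) : damped_signal w -> 0 < x ->
  mu.-integrable setT (EFin \o (fun t => w t * expR (- (x * t)) * cos (o * t))).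
Proof.
move=> wL x0; apply: (integrable_mul_bounded (C := 1) (wL.2 x x0)).
  exact: (is_derive_continuous (is_derive_cos_mull o)).
by move=> t; rewrite ler_norml cos_geN1 cos_le1.
Qed.

Lemma integrable_damped_sin w (x o : R) : damped_signal w -> 0 < x ->
  mu.-integrable setT (EFin \o (fun t => w t * expR (- (x * t)) * sin (o * t))).
Proof.
move=> wL x0; apply: (integrable_mul_bounded (C := 1) (wL.2 x x0)).
  exact: (is_derive_continuous (is_derive_sin_mull o)).
by move=> t; rewrite ler_norml sin_geN1 sin_le1.
Qed.

Lemma laplaceE w (x o : R) : damped_signal w -> 0 < x ->
  laplace w (x +i* o) =
  (\int[mu]_t (w t * expR (- (x * t)) * cos (o * t))) +i*
  (- \int[mu]_t (w t * expR (- (x * t)) * sin (o * t))).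
Proof.
move=> wL x0; have [w0 _] := wL; rewrite /laplace /cintegral.
have CM (r p q : R) : r%:C * (p +i* q) = (r * p) +i* (r * q).
  by apply/eqP; rewrite eq_complex /= !mul0r subr0 addr0 !eqxx.
have e t : (w t)%:C * cexp (- ((x +i* o) * t%:C)) =
    (w t * expR (- (x * t)) * cos (o * t)) +i* (- (w t * expR (- (x * t)) * sin (o * t))).
  have -> : - ((x +i* o) * t%:C) = (- (x * t)) +i* (- (o * t)).
    by apply/eqP; rewrite eq_complex /= !mulr0 subr0 add0r !eqxx.
  rewrite /cexp -[complex.Re _]/(- (x * t)) -[complex.Im _]/(- (o * t)) cosN sinN.
  by rewrite !CM !mulrN !mulrA.
congr (_ +i* _).
  rewrite Rintegral_mkcond; apply: eq_Rintegral => t _; rewrite patchE e.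
  by case: ifPn => //; rewrite mem_setE in_itv/= andbT -ltNge => /w0 ->; rewrite !mul0r.
transitivity (\int[mu]_t (-1 * (w t * expR (- (x * t)) * sin (o * t)))).
  rewrite Rintegral_mkcond; apply: eq_Rintegral => t _; rewrite patchE e mulN1r.
  by case: ifPn => //; rewrite mem_setE in_itv/= andbT -ltNge => /w0 ->; rewrite !mul0r oppr0.
by rewrite RintegralZl ?mulN1r//; exact: integrable_damped_sin.
Qed.

(** With k = cos or sin this makes the real and imaginary parts of W continuous on each line Re s =
    x > 0, from which their measurability follows. *)
Lemma continuous_under_bounded (f k : R -> R) : mu.-integrable setT (EFin \o f) ->
    continuous k -> (forall t, `|k t| <= 1) ->
  continuous (fun o : R => \int[mu]_t (f t * k (o * t))).
Proof.
move=> iF ck k1 o.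
have cko (c : R) : continuous (fun t => k (c * t)).
  move=> t; apply: (continuous_comp (f := fun t => c * t)); last exact: ck.
  by apply: cvgMr; exact: cvg_id.
have int_f o' : `]o - 1, o + 1[%classic o' -> mu.-integrable setT (EFin \o (fun t => f t * k (o' * t))).
  by move=> _; apply: (integrable_mul_bounded (C := 1)).
have cf : {ae mu, forall y, setT y -> {in `]o - 1, o + 1[%classic, continuous (fun o' : R => f y * k (o' * y))}}.
  apply: aeW => y _ o' _; apply: cvgMr; move: o'.
  by under [X in continuous X]eq_fun do rewrite mulrC; exact: cko.
have bf o' : `]o - 1, o + 1[%classic o' -> {ae mu, forall y, setT y -> `|f y * k (o' * y)| <= `|f y|}.
  by move=> _; apply: aeW => y _; rewrite normrM ler_piMr.
apply: (continuity_under_integral measurableT int_f cf (integrable_normr iF) bf).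
by rewrite inE /= in_itv/=; apply/andP; split; lra.
Qed.

Lemma cmeasurable_laplace_line w W (x : R) : damped_signal w -> is_laplace_transform w W ->
  0 < x -> cmeasurable (setT : set Rm) (fun o => W (x +i* o)).
Proof.
move=> wL [WE _ _] x0; have iF := wL.2 x x0.
have -> : (fun o => W (x +i* o)) = fun o =>
  (\int[mu]_t (w t * expR (- (x * t)) * cos (o * t))) +i*
  (- \int[mu]_t (w t * expR (- (x * t)) * sin (o * t))).
  by apply/funext => o; rewrite WE// laplaceE.
split.
  apply: (continuous_measurable_fun (f := fun o => \int[mu]_t (w t * expR (- (x * t)) * cos (o * t)))).
  apply: (continuous_under_bounded iF); first exact: continuous_cos.
  by move=> t; rewrite ler_norml cos_geN1 cos_le1.
apply: (continuous_measurable_fun (f := fun o => - \int[mu]_t (w t * expR (- (x * t)) * sin (o * t)))).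
move=> o; apply: cvgN; apply: (continuous_under_bounded iF); first exact: continuous_sin.
by move=> t; rewrite ler_norml sin_geN1 sin_le1.
Qed.

Lemma Re_laplace_resolvent w W (x a o : R) : damped_signal w -> is_laplace_transform w W ->
  0 < x -> 0 < a ->
  complex.Re (W (x +i* o) * resolvent a o) =
  resolvent_transform a (fun t => w t * expR (- (x * t))) o.
Proof.
move=> wL [WE _ _] x0 a0; rewrite WE// laplaceE// ReM /resolvent ReV ImV resolventE /=.
rewrite /resolvent_transform /resolvent_kernel sqrrN.
set f := fun t => w t * expR (- (x * t)).
set q := (a ^+ 2 + o ^+ 2)^-1.
transitivity (\int[mu]_t ((a * q) * (f t * cos (o * t)) + (o * q) * (f t * sin (o * t)))).
  rewrite RintegralD//; [|apply: integrable_mull => //; exact: integrable_damped_cos|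
    apply: integrable_mull => //; exact: integrable_damped_sin].
  rewrite !RintegralZl//; [ring|exact: integrable_damped_sin|exact: integrable_damped_cos].
by apply: eq_Rintegral => t _; rewrite /f; ring.
Qed.

(** On the line Re s = x a delay contributes e^(-x tau) through the damping and e^(-a tau) through
    the resolvent. As x -> 0+ the product tends to e^(-a tau), and both pairings tend to those of
    the boundary values. *)
Lemma pairing_resolvent_delay (tau a : R) w W V : 0 <= tau -> 0 < a -> damped_signal w ->
    is_laplace_transform w W -> is_laplace_transform (cdelay tau w) V ->
  pairing (setT : set Rm) (fun o => V (o *i)) (resolvent a) =
  expR (- (a * tau)) * pairing (setT : set Rm) (fun o => W (o *i)) (resolvent a).
Proof.
move=> tau0 a0 wL lW lV; have vL := damped_signal_delay tau0 wL.
have [_ sW cW] := lW; have [_ sV cV] := lV.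
have sr := square_integrable_resolvent a0.
have near0 : \forall x \near (0 : R)^'+, 0 < x by exact: nbhs_right_gt.
have mWn : \forall x \near (0 : R)^'+, cmeasurable (setT : set Rm) (fun o => W (x +i* o)).
  by apply: filterS near0 => x; exact: (cmeasurable_laplace_line wL lW).
have mVn : \forall x \near (0 : R)^'+, cmeasurable (setT : set Rm) (fun o => V (x +i* o)).
  by apply: filterS near0 => x; exact: (cmeasurable_laplace_line vL lV).
have [sWn lim1] := pairing_cvg _ measurableT sW sr mWn cW.
have [sVn lim2] := pairing_cvg _ measurableT sV sr mVn cV.
have lim3 : expR (- (a + x) * tau) * pairing (setT : set Rm) (fun o => W (x +i* o)) (resolvent a) @[x --> (0 : R)^'+]
   --> expR (- (a * tau)) * pairing (setT : set Rm) (fun o => W (o *i)) (resolvent a).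
  apply: cvgM => //; apply: cvg_at_right_filter.
  have -> : - (a * tau) = - (a + 0) * tau by ring.
  apply: (continuous_comp (f := fun x : R => - (a + x) * tau)); last exact: continuous_expR.
  apply: cvgMl; apply: cvgN; apply: cvgD; [exact: cvg_cst|exact: cvg_id].
suff lim4 : pairing (setT : set Rm) (fun o => V (x +i* o)) (resolvent a) @[x --> (0 : R)^'+]
   --> expR (- (a * tau)) * pairing (setT : set Rm) (fun o => W (o *i)) (resolvent a).
  exact: (cvg_unique _ lim2 lim4).
apply: cvg_trans lim3; apply: near_eq_cvg; near=> x.
have x0 : 0 < x by near: x.
have sWx : square_integrable (setT : set Rm) (fun o => W (x +i* o)) by near: x.
have sVx : square_integrable (setT : set Rm) (fun o => V (x +i* o)) by near: x.
(* Products of two square-integrable functions are integrable: this is the source of the two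
   integrability hypotheses of [resolvent_transform_delay]. *)
have iW := pairing_integrable measurableT sWx sr.
have iV := pairing_integrable measurableT sVx sr.
pose f t := w t * expR (- (x * t)).
have WE : (fun o => complex.Re (W (x +i* o) * resolvent a o)) = resolvent_transform a f.
  by apply/funext => o; exact: Re_laplace_resolvent.
pose e := expR (- (x * tau)).
have ifd : mu.-integrable setT (EFin \o (fun t => f (t - tau))).
  by apply: integrable_shift; exact: wL.2.
have irk o : mu.-integrable setT (EFin \o (fun t => f (t - tau) * resolvent_kernel a o t)).
  apply: (integrable_mul_bounded ifd _ (fun t => resolvent_kernel_le o t a0)) => t.
  apply: cvgMl; apply: cvgD; apply: cvgMr.
    exact: (is_derive_continuous (is_derive_cos_mull o)).
  exact: (is_derive_continuous (is_derive_sin_mull o)).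
(* Damping the delayed signal gives e times the delay of the damped signal. *)
have VE : (fun o => complex.Re (V (x +i* o) * resolvent a o)) =
    (fun o => e * resolvent_transform a (fun t => f (t - tau)) o).
  apply/funext => o; rewrite (Re_laplace_resolvent _ vL lV)//.
  rewrite /resolvent_transform -RintegralZl//.
  apply: eq_Rintegral => t _; rewrite mulrA; congr (_ * _).
  exact: delay_expR.
have e0 : e != 0 by rewrite gt_eqF// expR_gt0.
have iSd : mu.-integrable setT (EFin \o resolvent_transform a (fun t => f (t - tau))).
  rewrite VE in iV; have := integrable_mull measurableT e^-1 iV.
  by under [X in integrable _ _ X]eq_fun do rewrite /= mulrA mulVf// mul1r.
rewrite /pairing VE WE (RintegralZl e measurableT iSd).
have f0 t : t < 0 -> f t = 0 by move=> t0; rewrite /f (wL.1 _ t0) mul0r.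
have iSf : mu.-integrable setT (EFin \o resolvent_transform a f) by rewrite -WE.
rewrite (resolvent_transform_delay a0 tau0 (wL.2 x x0) f0 iSf iSd).
by rewrite mulrA -expRD; congr (expR _ * _); ring.
Unshelve. all: by end_near. Qed.

End ContinuousTime.

(** * Laguerre functions and the recurrence in continuous time *)

Section ContinuousMarkov.
Context {R : realType}.
Local Notation Rm := (measurableTypeR R).
Local Notation mu := (@lebesgue_measure R).
Local Notation normc := ComplexField.Normc.normc.
Local Open Scope complex_scope.

Lemma Re_inv_2pii (z : R[i]) :
  complex.Re ((2 * pi%:C * 'i)^-1 * z) = (2 * pi)^-1 * complex.Im z.
Proof.
have -> : (2 * pi%:C * 'i)^-1 = (2 * pi)^-1%:C * - 'i :> R[i].
  have -> : 2 * pi%:C = (2 * pi)%:C :> R[i] by rewrite rmorphM /= rmorph_nat.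
  rewrite invfM -fmorphV; congr (_ * _).
  by apply/eqP; rewrite eq_complex /= !expr0n expr1n /= add0r !(invr1, mulr1, mul0r, oppr0) !eqxx.
by rewrite -mulrA ReZ; congr (_ * _); case: z => x y /=; ring.
Qed.

(** The factor i of ds = i d(omega) cancels the one in 2 pi i. *)
Lemma Re_cinner (W V : R[i] -> R[i]) : complex.Re (cinner W V) =
  (2 * pi)^-1 * pairing (setT : set Rm) (fun o => W (o *i)) (fun o => V (- (o *i))).
Proof.
rewrite /cinner Re_inv_2pii /vline_integral /cintegral /=; congr (_ * _).
by apply: eq_Rintegral => o _; rewrite ImiRe.
Qed.

(** With s = -i omega and a = p (1 + l) / (1 - l), (s + p) - l (s - p) = (1 - l) (s + a): summing
    the geometric series moves the pole, and a stays positive for |l| <= 1/2. *)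
Lemma claguerre_geometric (p l : R) (o : R) : 0 < p -> `|l| <= 2^-1 ->
  ((Num.sqrt (2 * p))%:C / (- (o *i) + p%:C)) /
   (1 - l%:C * ((- (o *i) - p%:C) / (- (o *i) + p%:C))) =
  (Num.sqrt (2 * p) / (1 - l))%:C * resolvent (p * (1 + l) / (1 - l)) o.
Proof.
move=> p0 l2.
have l1 : 1 - l != 0 by move: l2 => /ler_normlP[? ?]; rewrite gt_eqF//; lra.
have neq0 (a b : R) : 0 < a -> - (b *i) + a%:C != 0.
  by move=> a0; rewrite eq_complex /= oppr0 add0r gt_eqF.
have a0 : 0 < p * (1 + l) / (1 - l).
  by move: l2 => /ler_normlP[? ?]; rewrite divr_gt0// ?mulr_gt0//; lra.
rewrite /resolvent (addrC _ (- (o *i))).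
have h1 := neq0 _ o p0; have h2 := neq0 _ o a0.
have l1C : (1 - l)%:C != 0 by rewrite fmorph_eq0.
have -> : (Num.sqrt (2 * p) / (1 - l))%:C = (Num.sqrt (2 * p))%:C / (1 - l)%:C.
  by rewrite rmorphM /= fmorphV.
have e : (p * (1 + l) / (1 - l))%:C = p%:C * (1 + l)%:C / (1 - l)%:C.
  by rewrite !rmorphM /= fmorphV.
have e1 : (1 - l)%:C = 1 - l%:C by rewrite rmorphB rmorph1.
have e2 : (1 + l)%:C = 1 + l%:C by rewrite rmorphD rmorph1.
move: h2; rewrite e e1 e2; rewrite e1 in l1C.
move: (o *i) (p%:C) (l%:C) (Num.sqrt _)%:C h1 l1C => w P L S h1 l1C h2.
have -> : 1 - L * ((- w - P) / (- w + P)) =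
    (1 - L) * (- w + P * (1 + L) / (1 - L)) / (- w + P).
  by field; rewrite l1C h1.
move: (- w + P * (1 + L) / (1 - L)) (- w + P) h2 h1 => A B A0 B0.
by field; rewrite A0 l1C B0.
Qed.

Lemma claguerre_markov (p tau : R) (u : R -> R) (us ys : nat -> R) : 0 < p -> 0 <= tau ->
    L2_signal u -> is_claguerre_spectrum p u us -> us 0%N != 0 ->
    is_claguerre_spectrum p (cdelay tau u) ys ->
  forall m, let h := markov_parameter us ys in
  m.+1%:R * h m.+1 + -2 * m%:R * h m + m.-1%:R * h m.-1 = - (2 * p * tau) * h m.
Proof.
move=> p0 tau0 uL [U lU usE] u0 [Y lY ysE].
have uD := L2_damped_signal uL.
have [_ sU _] := lU; have [_ sY _] := lY.
pose k0 o : R[i] := (Num.sqrt (2 * p))%:C / (- (o *i) + p%:C).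
pose m0 o : R[i] := (- (o *i) - p%:C) / (- (o *i) + p%:C).
have k0E o : k0 o = (Num.sqrt (2 * p))%:C * resolvent p o.
  by rewrite /k0 /resolvent addrC.
have mr := @cmeasurable_resolvent R p.
have mk0 : cmeasurable (setT : set Rm) k0.
  rewrite (funext k0E).
  apply: (cmeasurableM measurableT _ mr); exact: cmeasurable_cst.
have sk0 : square_integrable (setT : set Rm) k0.
  apply: (square_integrable_le (c := Num.sqrt (2 * p)) _ _ (square_integrable_resolvent p0) mk0 _).1 => //.
  by move=> o _; rewrite k0E ComplexField.Normc.normcM normcR ger0_norm// sqrtr_ge0.
have m0E o : m0 o = 1 - (2 * p)%:C * resolvent p o.
  rewrite /m0 /resolvent (addrC _ (- (o *i))).
  have h : - (o *i) + p%:C != 0 :> R[i].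
    by rewrite eq_complex /= oppr0 add0r gt_eqF.
  have -> : (2 * p)%:C = 2 * p%:C :> R[i] by rewrite rmorphM /= rmorph_nat.
  by field.
have mm0 : cmeasurable (setT : set Rm) m0.
  rewrite (funext m0E).
  apply: (cmeasurableB measurableT); first exact: cmeasurable_cst.
  apply: (cmeasurableM measurableT _ mr); exact: cmeasurable_cst.
have m01 o : setT o -> normc (m0 o) = 1.
  move=> _; rewrite /m0 ComplexField.Normc.normcM ComplexField.Normc.normcV.
  have -> : - (o *i) - p%:C = (- p) +i* (- o).
    by apply/eqP; rewrite eq_complex /= subr0 oppr0 add0r !eqxx.
  have -> : - (o *i) + p%:C = p +i* (- o).
    by apply/eqP; rewrite eq_complex /= addr0 oppr0 add0r !eqxx.
  rewrite /= !sqrrN divff// gt_eqF// sqrtr_gt0; exact: sqrD_gt0.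
have spE W ws : (forall j, (ws j)%:C = cinner W (claguerre p j)) ->
   forall j, ws j = (2 * pi)^-1 * pairing (setT : set Rm) (fun o => W (o *i)) (fun o => k0 o * m0 o ^+ j).
  by move=> wsE j; rewrite -[LHS]/(complex.Re (ws j)%:C) wsE Re_cinner.
pose a l := p * (1 + l) / (1 - l).
(* The inverse of e^(-a tau). As a' = 2 p / (1 - l)^2, it satisfies (1 - l)^2 G' = 2 p tau G, the
   origin of the coefficients -2 and -(2 p tau) below. *)
pose G l := expR (a l * tau).
pose G' l := G l * (p * tau * 2 / (1 - l) ^+ 2).
have l1 (l : R) : `|l| < 2^-1 -> 1 - l != 0.
  by move=> /ltr_normlP[? ?]; rewrite gt_eqF//; lra.
have dG (l : R) : `|l| < 2^-1 -> is_derive l 1 G (G' l).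
  move=> l2; have l10 := l1 _ l2.
  have da : is_derive l 1 a (p * 2 / (1 - l) ^+ 2).
    have d1 : is_derive l 1 (fun l => 1 - l : R) (-1).
      by have := is_deriveB (is_derive_cst (1 : R) l 1) (is_derive_id l 1); rewrite sub0r.
    have d2 : is_derive l 1 (fun l => (1 - l)^-1 : R) (- (1 - l) ^- 2 *: (-1)).
      exact: is_deriveV.
    have d3 : is_derive l 1 (fun l => 1 + l : R) 1.
      by have := is_deriveD (is_derive_cst (1 : R) l 1) (is_derive_id l 1); rewrite add0r.
    rewrite /a; apply: is_derive_eq; rewrite -![_ *: _]/(_ * _); field; exact: l10.
  have dat : is_derive l 1 (fun l => a l * tau) (p * 2 / (1 - l) ^+ 2 * tau).
    by apply: is_derive_eq; rewrite -![_ *: _]/(_ * _); ring.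
  have := is_derive1_comp (f := expR) (g := fun l => a l * tau) (is_derive_expR _) dat.
  suff <- : G' l = expR (a l * tau) * (p * 2 / (1 - l) ^+ 2 * tau) by [].
  by rewrite /G' /G; ring.
have h20 : 0 < 2^-1 :> R by rewrite invr_gt0.
apply: (@markov_of_pairings R setT (fun o => U (o *i)) (fun o => Y (o *i)) k0 m0 (2 * pi)^-1 (-2) (- (2 * p * tau)) 2^-1 G G') => //.
- exact: spE.
- exact: spE.
- move=> l l2; rewrite /G'; have := l1 _ l2 => l10; field; exact: l10.
- by rewrite gt_eqF// expR_gt0.
- move=> l l2.
  have a0 : 0 < a l.
    by move: l2 => /ltr_normlP[? ?]; rewrite /a divr_gt0// ?mulr_gt0//; lra.
  have KE (W : R -> R[i]) : square_integrable setT W ->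
      pairing (setT : set Rm) W (fun o => k0 o / (1 - l%:C * m0 o)) =
      Num.sqrt (2 * p) / (1 - l) * pairing (setT : set Rm) W (resolvent (a l)).
    move=> sW; rewrite /pairing -RintegralZl//; last first.
      by apply: pairing_integrable => //; exact: square_integrable_resolvent.
    apply: eq_Rintegral => o _; rewrite -ReZ; congr complex.Re.
    by rewrite /k0 /m0 (claguerre_geometric o p0 (ltW l2)) mulrCA.
  rewrite !KE// (pairing_resolvent_delay tau0 a0 uD lU lY) /G.
  rewrite mulrCA; congr (_ * _); rewrite mulrA -expRD subrr expR0 mul1r//.
Qed.

End ContinuousMarkov.

(** * Discrete time *)

Section DiscreteTime.
Context {R : realType}.
Local Notation Rm := (measurableTypeR R).
Local Notation mu := (@lebesgue_measure R).
Local Notation normc := ComplexField.Normc.normc.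
Implicit Types (w u : nat -> R) (W V : R[i] -> R[i]) (r b q th : R).
Local Open Scope complex_scope.

Lemma cvg_complex (u v : nat -> R) (a b : R) : u @ \oo --> a -> v @ \oo --> b ->
  (fun n => (u n +i* v n) : R[i]^o) @ \oo --> (a +i* b : R[i]^o).
Proof.
(* The norm of [R[i]] is complex-valued: 0 < e says that e is real and positive, so its real part is
   the tolerance. *)
move=> ua vb; apply/cvgrPdist_lt => /= e; rewrite ltcE => /andP[/eqP /= ie e0].
have e20 : 0 < complex.Re e / 2 by rewrite divr_gt0.
have /cvgrPdist_lt /(_ _ e20) un := ua; have /cvgrPdist_lt /(_ _ e20) vn := vb.
near=> n.
have un' : `|a - u n| < complex.Re e / 2 by near: n.
have vn' : `|b - v n| < complex.Re e / 2 by near: n.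
rewrite normc_def ltcE /= -ie eqxx /=.
rewrite (@le_lt_trans _ _ (`|a - u n| + `|b - v n|))//; last by lra.
rewrite -(ler_pXn2r (n := 2)) ?nnegrE ?sqrtr_ge0 ?addr_ge0//.
rewrite sqr_sqrtr ?addr_ge0 ?sqr_ge0// [leRHS]sqrrD !real_normK ?num_real// lerD2r lerDl.
by rewrite mulrn_wge0// mulr_ge0.
Unshelve. all: by end_near. Qed.

Lemma Re_sum n (f : nat -> R[i]) :
  complex.Re (\sum_(0 <= i < n) f i) = \sum_(0 <= i < n) complex.Re (f i).
Proof. by apply: (big_morph _ ReD). Qed.

Lemma Im_sum n (f : nat -> R[i]) :
  complex.Im (\sum_(0 <= i < n) f i) = \sum_(0 <= i < n) complex.Im (f i).
Proof. by apply: (big_morph (@complex.Im R)) => // -[? ?] [? ?]. Qed.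

Lemma cexp_imag th : cexp (th *i) = cos th +i* sin th :> R[i].
Proof. by rewrite /cexp /= expR0 mul1r. Qed.

Lemma normc_circle th : normc (cexp (th *i)) = 1.
Proof. by rewrite cexp_imag /= cos2Dsin2 sqrtr1. Qed.

Lemma circle_neq0 th : cexp (th *i) != 0.
Proof. by apply: normc_gt0_neq0; rewrite normc_circle. Qed.

Lemma circleV th : (cexp (th *i))^-1 = cos th +i* (- sin th).
Proof.
apply: (mulfI (circle_neq0 th)); rewrite mulfV ?circle_neq0// cexp_imag.
apply/eqP; rewrite eq_complex /=; apply/andP; split; apply/eqP; last by ring.
by rewrite -[LHS](cos2Dsin2 th); ring.
Qed.

Lemma circleXV th n : (cexp (th *i)) ^- n = cos (n%:R * th) +i* (- sin (n%:R * th)).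
Proof.
elim: n => [|n IH]; first by rewrite expr0 invr1 mul0r cos0 sin0 oppr0.
rewrite exprSr invfM IH circleV -natr1 mulrDl mul1r cosD sinD.
by apply/eqP; rewrite eq_complex /=; apply/andP; split; apply/eqP; ring.
Qed.

Lemma zseries_term w r th t : r != 0 ->
  (w t)%:C * (r%:C * cexp (th *i)) ^- t.+1 =
  (w t * r^-1 ^+ t.+1 * cos (t.+1%:R * th)) +i* (- (w t * r^-1 ^+ t.+1 * sin (t.+1%:R * th))).
Proof.
move=> r0; rewrite exprMn invfM circleXV -rmorphXn -fmorphV -exprVn /= mulrA -rmorphM.
by apply/eqP; rewrite eq_complex /= !mul0r subr0 addr0 !mulrN !eqxx.
Qed.

(** * The z-transform of a bounded sequence on a circle of radius r > 1 *)

Section Circle.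
Variables (w : nat -> R) (B r : R).
Hypotheses (r1 : 1 < r) (wB : forall t, `|w t| <= B).

Lemma radius_inv_lt1 : 0 < r^-1 < 1.
Proof. by rewrite invr_gt0 invf_lt1 ?(lt_trans ltr01 r1)// r1. Qed.

Lemma power_sum_le n : \sum_(0 <= t < n) B * r^-1 ^+ t.+1 <= B / (1 - r^-1).
Proof.
have /andP[q0 q1] := radius_inv_lt1.
have B0 : 0 <= B by exact: le_trans (wB 0).
have -> : \sum_(0 <= t < n) B * r^-1 ^+ t.+1 = series (geometric (B * r^-1) r^-1) n.
  by rewrite /series /=; apply: eq_bigr => t _; rewrite exprS mulrA.
rewrite geometric_seriesE ?lt_eqF//= ler_pM2r ?invr_gt0 ?subr_gt0//.
rewrite -[leRHS]mulr1 -mulrA ler_wpM2l//.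
have qn : 0 <= r^-1 ^+ n by rewrite exprn_ge0// ltW.
by nra.
Qed.

Lemma cvg_bounded_series (k : nat -> R) (C : R) : (forall t, `|k t| <= C) ->
  cvgn (series (fun t => w t * r^-1 ^+ t.+1 * k t)).
Proof.
move=> kC; have /andP[q0 q1] := radius_inv_lt1.
apply: normed_cvg.
apply: (@series_le_cvg _ _ (geometric (B * r^-1 * C) r^-1)) => [n|n|n|].
- exact: normr_ge0.
- rewrite /= mulr_ge0 ?exprn_ge0 ?(ltW q0)// mulr_ge0 ?(le_trans _ (kC 0%N))//.
  by rewrite mulr_ge0 ?(ltW q0)// (le_trans _ (wB 0%N)).
- rewrite /= !normrM normrX (gtr0_norm q0) exprS.
  have -> : B * r^-1 * C * r^-1 ^+ n = B * (r^-1 * r^-1 ^+ n) * C by ring.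
  rewrite ler_pM// ?mulr_ge0 ?exprn_ge0 ?(ltW q0)//.
  by rewrite ler_pM2r// mulr_gt0 ?exprn_gt0.
- by apply: is_cvg_geometric_series; rewrite gtr0_norm.
Qed.

Definition circle_cos th := limn (series (fun t => w t * r^-1 ^+ t.+1 * cos (t.+1%:R * th))).
Definition circle_sin th := limn (series (fun t => w t * r^-1 ^+ t.+1 * sin (t.+1%:R * th))).

Lemma cvg_circle_cos th : series (fun t => w t * r^-1 ^+ t.+1 * cos (t.+1%:R * th)) @ \oo --> circle_cos th.
Proof.
by apply: (cvg_bounded_series (C := 1)) => t; rewrite ler_norml cos_geN1 cos_le1.
Qed.

Lemma cvg_circle_sin th : series (fun t => w t * r^-1 ^+ t.+1 * sin (t.+1%:R * th)) @ \oo --> circle_sin th.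
Proof.
by apply: (cvg_bounded_series (C := 1)) => t; rewrite ler_norml sin_geN1 sin_le1.
Qed.

Lemma zseries_circle th :
  zseries w (r%:C * cexp (th *i)) = circle_cos th +i* (- circle_sin th).
Proof.
have r0 : r != 0 by rewrite gt_eqF// (lt_trans ltr01 r1).
rewrite /zseries; apply: (@cvg_lim _ (@norm_hausdorff R[i] (R[i]^o))).
have sN : (fun n => - series (fun t => w t * r^-1 ^+ t.+1 * sin (t.+1%:R * th)) n) @ \oo -->
    - circle_sin th by apply: cvgN; exact: cvg_circle_sin.
have := cvg_complex (cvg_circle_cos (th := th)) sN.
apply: cvg_trans; apply: near_eq_cvg; near=> n.
apply/eqP; rewrite /series /= eq_complex Re_sum Im_sum /= -sumrN; apply/andP.
by split; apply/eqP/eq_bigr => t _; rewrite zseries_term.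
Unshelve. all: by end_near. Qed.

Local Notation D := (`[0, 2 * pi]%classic : set Rm).

Lemma measurable_circle : measurable D.
Proof. exact: measurable_itv. Qed.

Lemma continuous_cos_mul (c : R) : continuous (fun th => cos (c * th)).
Proof. exact: (is_derive_continuous (is_derive_cos_mull c)). Qed.

Lemma continuous_sin_mul (c : R) : continuous (fun th => sin (c * th)).
Proof. exact: (is_derive_continuous (is_derive_sin_mull c)). Qed.

Lemma measurable_continuous (f : R -> R) : continuous f -> measurable_fun D f.
Proof.
by move=> cf; apply: (measurable_funS measurableT) => //; exact: (continuous_measurable_fun cf).
Qed.

Lemma cmeasurable_circle W : is_ztransform w W ->
  cmeasurable D (fun th => W (r%:C * cexp (th *i))).
Proof.
move=> [WE _ _].
have r0 : 0 < r := lt_trans ltr01 r1.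
have -> : (fun th => W (r%:C * cexp (th *i))) = fun th => circle_cos th +i* (- circle_sin th).
  apply/funext => th; rewrite WE ?zseries_circle//.
  by rewrite ComplexField.Normc.normcM normc_circle mulr1 normcR gtr0_norm.
have mS (k : R -> R) : (forall c : R, continuous (fun th => k (c * th))) ->
    forall n, measurable_fun D (fun th => series (fun t => w t * r^-1 ^+ t.+1 * k (t.+1%:R * th)) n).
  move=> ck n; rewrite /series /=; apply: measurable_sum => t.
  by apply: measurable_funM; [exact: measurable_cst|exact: measurable_continuous].
split.
  apply: (measurable_fun_cvg (mS _ continuous_cos_mul)) => th _; exact: cvg_circle_cos.
apply: measurable_funN.
apply: (measurable_fun_cvg (mS _ continuous_sin_mul)) => th _; exact: cvg_circle_sin.
Qed.

End Circle.

Local Notation D := (`[0, 2 * pi]%classic : set Rm).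

Definition circle_resolvent b th : R[i] := ((cexp (th *i))^-1 - b%:C)^-1.

(** The contribution of z^(-k) at |z| = 1 to the integrand of the pairing with
    [circle_resolvent b]. *)
Definition circle_mode b k th : R := complex.Re ((cexp (th *i)) ^- k * circle_resolvent b th).

Lemma circle_resolvent_neq0 b th : `|b| < 1 -> 1 - `|b| <= normc ((cexp (th *i))^-1 - b%:C).
Proof.
move=> b1; rewrite circleV.
have -> : (cos th -i* sin th) - b%:C = (cos th - b) +i* (- sin th).
  by apply/eqP; rewrite eq_complex /= subr0 !eqxx.
rewrite -(ler_pXn2r (n := 2)) ?nnegrE ?normc_ge0 ?subr_ge0 ?(ltW b1)//.
rewrite sqr_normc /= sqrrN.
have -> : (cos th - b) ^+ 2 + sin th ^+ 2 = 1 - 2 * b * cos th + b ^+ 2.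
  transitivity (cos th ^+ 2 + sin th ^+ 2 - 2 * b * cos th + b ^+ 2); first by ring.
  by rewrite cos2Dsin2.
have h : b * cos th <= `|b|.
  rewrite (le_trans (ler_norm _))// normrM ler_piMr// ler_norml cos_geN1 cos_le1//.
have : `|b| ^+ 2 = b ^+ 2 by rewrite real_normK ?num_real.
rewrite !expr2 => h2.
by move: (cos th) h h2 => c; nra.
Qed.

Lemma normc_circle_resolvent b th : `|b| < 1 -> normc (circle_resolvent b th) <= (1 - `|b|)^-1.
Proof.
move=> b1; rewrite ComplexField.Normc.normcV.
have h := circle_resolvent_neq0 th b1.
have b0 : 0 < 1 - `|b| by rewrite subr_gt0.
by rewrite lef_pV2// posrE (lt_le_trans b0).
Qed.

Lemma circle_mode_le b k th : `|b| < 1 -> `|circle_mode b k th| <= (1 - `|b|)^-1.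
Proof.
move=> b1; rewrite (le_trans (Re_le_normc _))// ComplexField.Normc.normcM.
by rewrite ComplexField.Normc.normcV normcX normc_circle expr1n invr1 mul1r normc_circle_resolvent.
Qed.

Lemma cmeasurable_circleXV k : cmeasurable D (fun th => (cexp (th *i)) ^- k).
Proof.
have -> : (fun th => (cexp (th *i)) ^- k) = fun th => cos (k%:R * th) +i* (- sin (k%:R * th)).
  by apply/funext => th; rewrite circleXV.
split; first by apply: measurable_continuous; exact: continuous_cos_mul.
by apply: measurable_funN; apply: measurable_continuous; exact: continuous_sin_mul.
Qed.

Lemma cmeasurable_circleV : cmeasurable D (fun th => (cexp (th *i))^-1).
Proof. exact: (cmeasurable_circleXV 1). Qed.

Lemma cmeasurable_circle_resolvent b : cmeasurable D (circle_resolvent b).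
Proof.
apply: cmeasurableV; first exact: measurable_circle.
apply: cmeasurableB; [exact: measurable_circle|exact: cmeasurable_circleV|].
exact: (cmeasurable_cst _ b%:C).
Qed.

Lemma integrable_circle (f : R -> R) (C : R) : measurable_fun D f -> (forall th, `|f th| <= C) ->
  mu.-integrable D (EFin \o f).
Proof.
move=> mf fC.
have iC : mu.-integrable D (EFin \o cst C).
  apply: (@continuous_compact_integrable R); first exact: segment_compact.
  by apply: continuous_subspaceT => x; exact: cvg_cst.
by apply: (integrable_le measurable_circle mf _ iC).
Qed.

Lemma square_integrable_circle (f : R -> R[i]) (C : R) : cmeasurable D f ->
  (forall th, normc (f th) <= C) -> square_integrable D f.
Proof.
move=> mf fC; apply/square_integrableP; first exact: measurable_circle.
split=> //; apply: (@integrable_circle _ (C ^+ 2)).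
  by apply: measurable_sqr_normc => //; exact: measurable_circle.
move=> th; rewrite ger0_norm ?sqr_ge0// lerXn2r ?nnegrE ?normc_ge0//.
exact: le_trans (normc_ge0 _) (fC th).
Qed.

Lemma square_integrable_circle_resolvent b : `|b| < 1 ->
  square_integrable D (circle_resolvent b).
Proof.
move=> b1; apply: square_integrable_circle => [|th].
  exact: cmeasurable_circle_resolvent.
exact: normc_circle_resolvent.
Qed.

Lemma measurable_circle_mode b k : measurable_fun D (circle_mode b k).
Proof.
by have [] := cmeasurableM measurable_circle (cmeasurable_circleXV k) (cmeasurable_circle_resolvent b).
Qed.

Lemma integrable_circle_mode b k : `|b| < 1 -> mu.-integrable D (EFin \o circle_mode b k).
Proof.
by move=> b1; apply: (integrable_circle (measurable_circle_mode b k)) => th; exact: circle_mode_le.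
Qed.

Lemma sin_2pi_mul k : sin (k%:R * (2 * pi)) = 0 :> R.
Proof.
elim: k => [|k IH]; first by rewrite mul0r sin0.
by rewrite -natr1 mulrDl mul1r sinD IH mulr_natl sin2pi mul0r mulr0 addr0.
Qed.

Lemma integral_circle_cos k : \int[mu]_(th in D) cos (k.+1%:R * th) = 0.
Proof.
have k0 : k.+1%:R != 0 :> R by rewrite pnatr_eq0.
have dF th : is_derive th 1 (fun th : R => k.+1%:R^-1 * sin (k.+1%:R * th)) (cos (k.+1%:R * th)).
  have ? := is_derive_sin_mull k.+1%:R th.
  by apply: is_derive_eq; rewrite -![_ *: _]/(_ * _); field; rewrite nat1r.
have p0 : (0 : R) < 2 * pi by rewrite mulr_gt0 ?pi_gt0.
rewrite (integral_is_derive p0 (@continuous_cos_mul k.+1%:R) dF).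
by rewrite sin_2pi_mul !mulr0 sin0 mulr0 subrr.
Qed.

(* e^(-i (k+2) th) - b e^(-i (k+1) th) = e^(-i (k+1) th) (e^(-i th) - b). *)
Lemma integral_circle_modeS b k : `|b| < 1 ->
  \int[mu]_(th in D) circle_mode b k.+2 th = b * \int[mu]_(th in D) circle_mode b k.+1 th.
Proof.
move=> b1; have ik k' := integrable_circle_mode k' b1.
rewrite -(RintegralZl b measurable_circle (ik k.+1)).
apply: subr0_eq; rewrite -RintegralB; [|exact: measurable_circle|exact: ik|
  exact: (integrable_mull measurable_circle b (ik k.+1))].
transitivity (\int[mu]_(th in D) cos (k.+1%:R * th)); last exact: integral_circle_cos.
apply: eq_Rintegral => th _.
rewrite /circle_mode -ReZ -ReB.
have -> : (cexp (th *i)) ^- k.+2 * circle_resolvent b th -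
    b%:C * ((cexp (th *i)) ^- k.+1 * circle_resolvent b th) = (cexp (th *i)) ^- k.+1.
  have h : (cexp (th *i))^-1 - b%:C != 0.
    by apply: normc_gt0_neq0; rewrite (lt_le_trans _ (circle_resolvent_neq0 th b1))// subr_gt0.
  rewrite /circle_resolvent -!exprVn exprS.
  move: (_^-1) h => z h.
  by field.
by rewrite circleXV.
Qed.

Lemma integral_circle_mode b k : `|b| < 1 ->
  \int[mu]_(th in D) circle_mode b k.+1 th = b ^+ k * \int[mu]_(th in D) circle_mode b 1 th.
Proof.
move=> b1; elim: k => [|k IH]; first by rewrite expr0 mul1r.
by rewrite integral_circle_modeS// IH exprS mulrA.
Qed.

(** For r > 1 the partial sums are bounded by a geometric series uniformly in theta, so dominated
    convergence applies with a constant majorant. For b != 0 the sum is W(r / b) up to a factor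
    independent of W. A bound on w suffices, and a delay preserves it. *)
Lemma pairing_circle w W b r (B : R) : `|b| < 1 -> 1 < r -> (forall t, `|w t| <= B) ->
    is_ztransform w W ->
  series (fun t => w t * r^-1 ^+ t.+1 * (b ^+ t * \int[mu]_(th in D) circle_mode b 1 th)) @ \oo -->
  pairing D (fun th => W (r%:C * cexp (th *i))) (circle_resolvent b).
Proof.
move=> b1 r1 wB [WE _ _].
have r0 : 0 < r := lt_trans ltr01 r1.
have /andP[q0 q1] := radius_inv_lt1 r1.
pose S n th := series (fun t => w t * r^-1 ^+ t.+1 * circle_mode b t.+1 th) n.
pose f th := complex.Re (W (r%:C * cexp (th *i)) * circle_resolvent b th).
have Sf th : S ^~ th @ \oo --> f th.
  have cc := @cvg_circle_cos w B r r1 wB th; have cs := @cvg_circle_sin w B r r1 wB th.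
  rewrite /f WE; last first.
    by rewrite ComplexField.Normc.normcM normc_circle mulr1 normcR gtr0_norm.
  rewrite (zseries_circle r1 wB) ReM /= mulNr opprK.
  have -> : S ^~ th = fun n =>
      series (fun t => w t * r^-1 ^+ t.+1 * cos (t.+1%:R * th)) n * complex.Re (circle_resolvent b th) +
      series (fun t => w t * r^-1 ^+ t.+1 * sin (t.+1%:R * th)) n * complex.Im (circle_resolvent b th).
    apply/funext => n; rewrite /S /series /= !mulr_suml -big_split /=.
    apply: eq_bigr => t _; rewrite /circle_mode circleXV ReM /=; ring.
  by apply: cvgD; apply: cvgMl.
pose C := B / (1 - r^-1) * (1 - `|b|)^-1.
have SC n th : `|S n th| <= C.
  rewrite /S /series /= (le_trans (ler_norm_sum _ _ _))//.
  rewrite (le_trans (ler_sum _ (G := fun t => B * r^-1 ^+ t.+1 * (1 - `|b|)^-1) _))//.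
    move=> t _; rewrite !normrM normrX (gtr0_norm q0) ler_pM ?circle_mode_le//.
      by rewrite mulr_ge0// exprn_ge0// ltW.
    by rewrite ler_pM2r// exprn_gt0.
  rewrite -mulr_suml /C ler_wpM2r//; last exact: power_sum_le wB n.
  by rewrite invr_ge0 subr_ge0 ltW.
have mS n : measurable_fun D (S n).
  rewrite /S /series /=; apply: measurable_sum => t.
  by apply: measurable_funM; [exact: measurable_cst|exact: measurable_circle_mode].
have mf : measurable_fun D f.
  by apply: (measurable_fun_cvg mS) => th _; exact: Sf.
have intS n : \int[mu]_(th in D) S n th =
    series (fun t => w t * r^-1 ^+ t.+1 * (b ^+ t * \int[mu]_(th in D) circle_mode b 1 th)) n.
  elim: n => [|n IH].
    rewrite /S /series /= big_geq//; under eq_Rintegral do rewrite big_geq//.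
    by rewrite Rintegral_cst ?mul0r//; exact: measurable_circle.
  rewrite [RHS]/series /= big_nat_recr//= -[X in X + _]/(series _ n) -IH.
  rewrite -(integral_circle_mode n b1).
  rewrite -RintegralZl; [|exact: measurable_circle|exact: integrable_circle_mode].
  rewrite -RintegralD; [|exact: measurable_circle|exact: (integrable_circle (mS n) (SC n))|
    apply: integrable_mull; [exact: measurable_circle|exact: integrable_circle_mode]].
  by apply: eq_Rintegral => th _; rewrite /S /series /= big_nat_recr.
have iC : mu.-integrable D (EFin \o cst C).
  apply: (@integrable_circle _ `|C|); first exact: measurable_cst.
  by move=> th; exact: lexx.
have if_ : mu.-integrable D (EFin \o f).
  apply: (integrable_circle (C := C) mf) => th.
  have h : (fun n => `|S n th|) @ \oo --> `|f th| by apply: cvg_norm; exact: Sf.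
  have hC : (fun=> C) @ \oo --> C by exact: cvg_cst.
  by apply: (ler_cvg_to h hC); exact: nearW.
have cvS : {ae mu, forall th, D th -> (S n th)%:E @[n --> \oo] --> (EFin \o f) th}.
  by apply: aeW => th _; apply: cvg_EFin; [exact: nearW|exact: Sf].
have bS : {ae mu, forall th n, D th -> (`|(S n th)%:E| <= (EFin \o cst C) th)%E}.
  by apply: aeW => th n _; rewrite lee_fin.
have mSE n : measurable_fun D (fun th => (S n th)%:E) by apply/measurable_EFinP.
have mfE : measurable_fun D (EFin \o f) by apply/measurable_EFinP.
have [_ _ h] := dominated_convergence measurable_circle mSE mfE cvS iC bS.
have : (fun n => \int[mu]_(th in D) S n th) @ \oo --> \int[mu]_(th in D) f th.
  by apply: fine_cvg; rewrite fineK ?(integrable_fin_num measurable_circle if_)//; exact: h.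
by under eq_cvg do rewrite intS.
Qed.

End DiscreteTime.

Section DiscreteMarkov.
Context {R : realType}.
Local Notation Rm := (measurableTypeR R).
Local Notation mu := (@lebesgue_measure R).
Local Notation normc := ComplexField.Normc.normc.
Local Open Scope complex_scope.
Local Notation D := (`[0, 2 * pi]%classic : set Rm).
Implicit Types (w u : nat -> R) (W V : R[i] -> R[i]).

Lemma l2_sequence_bounded w : l2_sequence w -> exists B, forall t, `|w t| <= B.
Proof.
move=> /cvg_series_cvg_0 w0.
have /cvg_seq_bounded [M [_ hM]] : cvgn (fun t => w t ^+ 2) by apply/cvg_ex; exists 0.
exists (1 + (`|M| + 1)) => t.
have := hM (`|M| + 1); rewrite (le_lt_trans (ler_norm _)) ?ltrDl// => /(_ isT t I) /=.
rewrite normrX; have := normr_ge0 (w t); move: (`|w t|) => x x0.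
by have := sqr_ge0 (x - 1); rewrite !expr2; nra.
Qed.

Lemma pairing_circle_delay tau w W V (b r B : R) : `|b| < 1 -> 1 < r ->
    (forall t, `|w t| <= B) -> is_ztransform w W -> is_ztransform (ddelay tau w) V ->
  pairing D (fun th => V (r%:C * cexp (th *i))) (circle_resolvent b) =
  (r^-1 * b) ^+ tau * pairing D (fun th => W (r%:C * cexp (th *i))) (circle_resolvent b).
Proof.
move=> b1 r1 wB zW zV.
have vB t : `|ddelay tau w t| <= B.
  by rewrite /ddelay; case: ifP => // _; rewrite normr0 (le_trans _ (wB 0%N)).
have limW := pairing_circle b1 r1 wB zW.
have limV := pairing_circle b1 r1 vB zV.
set K := \int[mu]_(th in D) circle_mode b 1 th in limW limV.
(* Of the n + tau terms for the delayed sequence the first tau vanish, and the others are those of w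
   with the additional factor (b / r)^tau. *)
have VW n : series (fun t => ddelay tau w t * r^-1 ^+ t.+1 * (b ^+ t * K)) (n + tau)%N =
    (r^-1 * b) ^+ tau * series (fun t => w t * r^-1 ^+ t.+1 * (b ^+ t * K)) n.
  rewrite /series /= (big_cat_nat (n := tau)) ?leq_addl//=.
  rewrite big_nat_cond big1 ?add0r; last first.
    by move=> t /andP[/andP[_ tt] _]; rewrite /ddelay tt !mul0r.
  rewrite -[X in \sum_(X <= _ < _) _]add0n big_addn addnK mulr_sumr.
  apply: eq_bigr => t _; rewrite /ddelay ltnNge leq_addl /= addnK.
  by rewrite -addSn !exprD exprMn; ring.
have limV' := limV; rewrite -(cvg_shiftn tau) in limV'.
have limW' : (fun n => (r^-1 * b) ^+ tau * series (fun t => w t * r^-1 ^+ t.+1 * (b ^+ t * K)) n) @ \oo -->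
    (r^-1 * b) ^+ tau * pairing D (fun th => W (r%:C * cexp (th *i))) (circle_resolvent b).
  by apply: cvgMr.
suff limV'' : (fun n => series (fun t => ddelay tau w t * r^-1 ^+ t.+1 * (b ^+ t * K)) (n + tau)%N) @ \oo -->
    (r^-1 * b) ^+ tau * pairing D (fun th => W (r%:C * cexp (th *i))) (circle_resolvent b).
  exact: (cvg_unique _ limV' limV'').
by rewrite (funext VW).
Qed.

Lemma pairing_circle_resolvent_delay tau w W V (b B : R) : `|b| < 1 ->
    (forall t, `|w t| <= B) -> is_ztransform w W -> is_ztransform (ddelay tau w) V ->
  pairing D (fun th => V (cexp (th *i))) (circle_resolvent b) =
  b ^+ tau * pairing D (fun th => W (cexp (th *i))) (circle_resolvent b).
Proof.
move=> b1 wB zW zV; have [_ sW cW] := zW; have [_ sV cV] := zV.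
have vB t : `|ddelay tau w t| <= B.
  by rewrite /ddelay; case: ifP => // _; rewrite normr0 (le_trans _ (wB 0%N)).
have sr := square_integrable_circle_resolvent b1.
have near1 : \forall r \near (1 : R)^'+, 1 < r by exact: nbhs_right_gt.
have mWn : \forall r \near (1 : R)^'+, cmeasurable D (fun th => W (r%:C * cexp (th *i))).
  by apply: filterS near1 => r r1; exact: (cmeasurable_circle r1 wB zW).
have mVn : \forall r \near (1 : R)^'+, cmeasurable D (fun th => V (r%:C * cexp (th *i))).
  by apply: filterS near1 => r r1; exact: (cmeasurable_circle r1 vB zV).
have [_ lim1] := pairing_cvg _ (@measurable_circle R) sW sr mWn cW.
have [_ lim2] := pairing_cvg _ (@measurable_circle R) sV sr mVn cV.
have lim3 : (r^-1 * b) ^+ tau * pairing D (fun th => W (r%:C * cexp (th *i))) (circle_resolvent b)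
    @[r --> (1 : R)^'+] --> b ^+ tau * pairing D (fun th => W (cexp (th *i))) (circle_resolvent b).
  apply: cvgM => //; apply: cvg_at_right_filter.
  have -> : b ^+ tau = (1^-1 * b) ^+ tau by rewrite invr1 mul1r.
  apply: (continuous_comp (f := fun r : R => r^-1 * b) (g := fun x : R => x ^+ tau)).
    by apply: cvgMl; apply: cvgV; [exact: oner_neq0|exact: cvg_id].
  exact: exprn_continuous.
suff lim4 : pairing D (fun th => V (r%:C * cexp (th *i))) (circle_resolvent b)
    @[r --> (1 : R)^'+] --> b ^+ tau * pairing D (fun th => W (cexp (th *i))) (circle_resolvent b).
  exact: (cvg_unique _ lim2 lim4).
apply: cvg_trans lim3; apply: near_eq_cvg; near=> r.
have r1 : 1 < r by near: r.
by rewrite (pairing_circle_delay b1 r1 wB zW zV).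
Unshelve. all: by end_near. Qed.

Lemma Re_dinner W V : complex.Re (dinner W V) =
  (2 * pi)^-1 * pairing D (fun th => W (cexp (th *i))) (fun th => V (cexp (th *i))^-1).
Proof.
rewrite /dinner Re_inv_2pii /circle_integral /cintegral /=; congr (_ * _).
apply: eq_Rintegral => th _.
have -> : W (cexp (th *i)) * V (cexp (th *i))^-1 / cexp (th *i) * ('i * cexp (th *i)) =
    W (cexp (th *i)) * V (cexp (th *i))^-1 * 'i.
  by have := circle_neq0 th; move: (cexp _) => z z0; field.
by rewrite ImiRe.
Qed.

(** With z = e^(-i theta) and b = (xi + l) / (1 + xi l), (z - xi) - l (1 - xi z) = (1 + xi l) (z -
    b). The condition |l| < xi gives 0 < b < 1, so b is off the unit circle and invertible. *)
Lemma dlaguerre_geometric (xi s l th : R) : 0 < xi < 1 -> `|l| < xi ->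
  let z := (cexp (th *i))^-1 in
  (s%:C / (z - xi%:C)) / (1 - l%:C * ((1 - xi%:C * z) / (z - xi%:C))) =
  (s / (1 + xi * l))%:C * circle_resolvent ((xi + l) / (1 + xi * l)) th.
Proof.
move=> /andP[xi0 xi1] lxi z.
have [lo hi] : - xi < l /\ l < xi by move: lxi => /ltr_normlP[? ?]; split; lra.
have d0 : 0 < 1 + xi * l by nra.
have b1 : `|(xi + l) / (1 + xi * l)| < 1.
  by rewrite normrM normfV (gtr0_norm d0) ltr_pdivrMr// mul1r gtr0_norm; nra.
have neq0 (c : R) : `|c| < 1 -> z - c%:C != 0.
  move=> c1; apply: normc_gt0_neq0.
  by rewrite (lt_le_trans _ (circle_resolvent_neq0 th c1))// subr_gt0.
have h1 : z - xi%:C != 0 by apply: neq0; rewrite gtr0_norm.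
have h2 := neq0 _ b1.
have dC : (1 + xi * l)%:C != 0 by rewrite fmorph_eq0 gt_eqF.
rewrite /circle_resolvent -/z.
have e1 : (1 + xi * l)%:C = 1 + xi%:C * l%:C by rewrite rmorphD rmorph1 rmorphM.
have e2 : ((xi + l) / (1 + xi * l))%:C = (xi%:C + l%:C) / (1 + xi%:C * l%:C).
  by rewrite -e1 -rmorphD -fmorphV -rmorphM.
have e3 : (s / (1 + xi * l))%:C = s%:C / (1 + xi%:C * l%:C).
  by rewrite -e1 -fmorphV -rmorphM.
rewrite e2 in h2 *; rewrite e1 in dC; rewrite e3.
clear neq0 e1 e2 e3; move: z (xi%:C) (l%:C) (s%:C) h1 h2 dC => z X L S h1 h2 dC.
have -> : 1 - L * ((1 - X * z) / (z - X)) =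
    (1 + X * L) * (z - (X + L) / (1 + X * L)) / (z - X).
  by field; rewrite dC h1.
move: (z - (X + L) / (1 + X * L)) h2 => A A0.
move: (z - X) (1 + X * L) h1 dC => B C B0 C0.
by field; rewrite A0 B0 C0.
Qed.

Lemma dlaguerre_markov (p : R) (tau : nat) (u us ys : nat -> R) : 0 < p -> p < 1 ->
    l2_sequence u -> is_dlaguerre_spectrum p u us -> us 0%N != 0 ->
    is_dlaguerre_spectrum p (ddelay tau u) ys ->
  forall m, let h := markov_parameter us ys in
  let xi := Num.sqrt p in
  m.+1%:R * h m.+1 + (xi + xi^-1) * m%:R * h m + m.-1%:R * h m.-1 =
  - (tau%:R * (xi - xi^-1)) * h m.
Proof.
move=> p0 p1 uL [U zU usE] u0 [Y zY ysE] m h xi; rewrite {}/h; move: m.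
have [B uB] := l2_sequence_bounded uL.
have [_ sU _] := zU; have [_ sY _] := zY.
have xi0 : 0 < xi by rewrite sqrtr_gt0.
have xi1 : xi < 1 by rewrite -sqrtr1 ltr_sqrt.
have xi01 : 0 < xi < 1 by rewrite xi0.
pose s := Num.sqrt (1 - p).
pose z th := (cexp (th *i))^-1 : R[i].
have zn0 th : z th - xi%:C != 0.
  apply: normc_gt0_neq0; rewrite (lt_le_trans _ (circle_resolvent_neq0 th _))//.
    by rewrite gtr0_norm// subr_gt0.
  by rewrite gtr0_norm.
pose k0 th : R[i] := s%:C / (z th - xi%:C).
pose m0 th : R[i] := (1 - xi%:C * z th) / (z th - xi%:C).
have mD := @measurable_circle R.
have mz := @cmeasurable_circleV R.
have mr := @cmeasurable_circle_resolvent R xi.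
have mk0 : cmeasurable D k0.
  by apply: (cmeasurableM mD _ mr); exact: cmeasurable_cst.
have sk0 : square_integrable D k0.
  apply: (square_integrable_le (c := s) mD _ (square_integrable_circle_resolvent (b := xi) _) mk0 _).1.
  - exact: sqrtr_ge0.
  - by rewrite gtr0_norm.
  - by move=> th _; rewrite /k0 ComplexField.Normc.normcM normcR ger0_norm ?sqrtr_ge0.
have mm0 : cmeasurable D m0.
  apply: (cmeasurableM mD _ mr); apply: (cmeasurableB mD); first exact: cmeasurable_cst.
  by apply: (cmeasurableM mD _ mz); exact: cmeasurable_cst.
have m01 th : D th -> normc (m0 th) = 1.
  move=> _; rewrite /m0 ComplexField.Normc.normcM ComplexField.Normc.normcV.
  suff -> : normc (1 - xi%:C * z th) = normc (z th - xi%:C).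
    by rewrite divff//; apply: contra (zn0 th) => /eqP /ComplexField.Normc.eq0_normc ->.
  (* For |z| = 1 both squared moduli equal 1 - 2 xi Re z + xi^2. *)
  rewrite /z circleV; apply/eqP; rewrite -(eqrXn2 (n := 2)) ?normc_ge0//; apply/eqP.
  rewrite !sqr_normc !ReB !ImB /= !mul0r !subr0 !addr0.
  transitivity (1 - 2 * xi * cos th + xi ^+ 2 * (cos th ^+ 2 + sin th ^+ 2)); first by ring.
  rewrite cos2Dsin2.
  transitivity ((cos th ^+ 2 + sin th ^+ 2) - 2 * xi * cos th + xi ^+ 2); last by ring.
  by rewrite cos2Dsin2 mulr1.
have spE W ws : (forall j, (ws j)%:C = dinner W (dlaguerre p j)) ->
   forall j, ws j = (2 * pi)^-1 * pairing D (fun th => W (cexp (th *i))) (fun th => k0 th * m0 th ^+ j).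
  by move=> wsE j; rewrite -[LHS]/(complex.Re (ws j)%:C) wsE Re_dinner.
(* The bound 1/2 serves the geometric remainder; xi keeps [xi + l] positive, so that [c], the
   inverse of b, has no pole. *)
pose d := Num.min 2^-1 xi.
have d0 : 0 < d by rewrite lt_min invr_gt0 ltr0n.
pose c (l : R) := (1 + xi * l) / (xi + l).
pose G (l : R) := c l ^+ tau.
(* The last factor is the logarithmic derivative xi / (1 + xi l) - 1 / (xi + l) of c. Its
   denominator is xi (1 + (xi + 1/xi) l + l^2), the quadratic of the recurrence up to xi. *)
pose G' (l : R) := tau%:R * G l * ((xi ^+ 2 - 1) / ((1 + xi * l) * (xi + l))).
have pos (l : R) : `|l| < d -> 0 < 1 + xi * l /\ 0 < xi + l.
  by rewrite lt_min => /andP[/ltr_normlP[? ?] /ltr_normlP[? ?]]; split; nra.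
have dG (l : R) : `|l| < d -> is_derive l 1 G (G' l).
  move=> /pos[e1 e2].
  have d1 : is_derive l 1 (fun l => 1 + xi * l : R) xi.
    by have := is_deriveD (is_derive_cst (1 : R) l 1) (is_derive_mull xi l); rewrite add0r.
  have d3 : is_derive l 1 (fun l => xi + l : R) 1.
    by have := is_deriveD (is_derive_cst xi l 1) (is_derive_id l 1); rewrite add0r.
  have d2 : is_derive l 1 (fun l => (xi + l)^-1 : R) (- (xi + l) ^- 2 *: 1).
    by apply: is_deriveV; rewrite gt_eqF.
  have dc : is_derive l 1 c ((xi ^+ 2 - 1) / (xi + l) ^+ 2).
    rewrite /c; apply: is_derive_eq; rewrite -![_ *: _]/(_ * _); field.
    by rewrite gt_eqF.
  have -> : G = c ^+ tau by apply/funext => x; rewrite /G fctE.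
  have := is_deriveX tau dc.
  suff <- : G' l = (tau%:R * c l ^+ tau.-1) *: ((xi ^+ 2 - 1) / (xi + l) ^+ 2) by [].
  (* The derivative of a power carries the exponent tau - 1; for tau = 0 its truncation is harmless,
     as the factor tau makes both sides 0. *)
  have key n : n%:R * c l ^+ n = n%:R * c l ^+ n.-1 * c l.
    by case: n => [|n]; rewrite ?mul0r// exprSr mulrA.
  rewrite /G' /G key -![_ *: _]/(_ * _) {2}/c; move: (_ * c l ^+ _) => ct; field.
  by rewrite !gt_eqF.
have e0 : d <= 2^-1 by rewrite ge_min lexx.
apply: (@markov_of_pairings R D (fun th => U (cexp (th *i))) (fun th => Y (cexp (th *i))) k0 m0 (2 * pi)^-1 (xi + xi^-1) (- (tau%:R * (xi - xi^-1))) d G G') => //.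
- exact: spE.
- exact: spE.
- move=> l /pos[e1 e2]; rewrite /G'; field.
  by rewrite !gt_eqF.
- by rewrite /G /c mulr0 addr0 addr0 expf_neq0// mulf_neq0 ?oner_neq0// invr_neq0// gt_eqF.
- move=> l ld; have [e1 e2] := pos _ ld.
  have lxi : `|l| < xi by move: ld; rewrite lt_min => /andP[].
  pose b := (xi + l) / (1 + xi * l).
  have b1 : `|b| < 1.
    move: lxi => /ltr_normlP[? ?].
    by rewrite /b normrM normfV (gtr0_norm e1) (gtr0_norm e2) ltr_pdivrMr// mul1r; nra.
  have KE (W : R -> R[i]) : square_integrable D W ->
      pairing D W (fun th => k0 th / (1 - l%:C * m0 th)) =
      s / (1 + xi * l) * pairing D W (circle_resolvent b).
    move=> sW; rewrite /pairing -(RintegralZl _ mD); last first.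
      by apply: pairing_integrable => //; exact: square_integrable_circle_resolvent.
    apply: eq_Rintegral => th _; rewrite -ReZ; congr complex.Re.
    by rewrite /k0 /m0 (dlaguerre_geometric s th xi01 lxi) mulrCA.
  rewrite !KE// (pairing_circle_resolvent_delay b1 uB zU zY) /G.
  rewrite mulrCA; congr (_ * _); rewrite mulrA -exprMn /c /b.
  by rewrite mulrA divfK ?divff ?expr1n ?mul1r// gt_eqF.
Qed.

End DiscreteMarkov.

(** * Solving the recurrences for the delay *)

Theorem proposition3 (R : realType) (m : nat) (m_ge1 : (1 <= m)%N) :
  (forall (p tau : R) (u : R -> R) (us ys : nat -> R),
     0 < p -> 0 <= tau ->
     L2_signal u ->
     is_claguerre_spectrum p u us ->
     us 0%N != 0 ->
     is_claguerre_spectrum p (cdelay tau u) ys ->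
     let h := markov_parameter us ys in
     let kappa := 2 * p * tau in
     h m != 0 ->
     kappa = - ((m.+1%:R * h m.+1 + m.-1%:R * h m.-1 - 2 * m%:R * h m) / h m))
  /\
  (forall (p : R) (tau : nat) (u us ys : nat -> R),
     0 < p -> p < 1 ->
     l2_sequence u ->
     is_dlaguerre_spectrum p u us ->
     us 0%N != 0 ->
     is_dlaguerre_spectrum p (ddelay tau u) ys ->
     let xi := Num.sqrt p in
     let h := markov_parameter us ys in
     h m != 0 ->
     tau%:R = - ((m.+1%:R * h m.+1 + m.-1%:R * h m.-1
                   + m%:R * (xi + xi^-1) * h m)
                 / ((xi - xi^-1) * h m))).
Proof.
split.
- move=> p tau u us ys p0 tau0 uL sU u0 sY h kappa hm.
  have := claguerre_markov p0 tau0 uL sU u0 sY m; rewrite -/h -/kappa /= => E.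
  apply: (mulIf hm); rewrite mulNr divfK//.
  by rewrite -[LHS]opprK -mulNr -E; congr (- _); ring.
- move=> p tau u us ys p0 p1 uL sU u0 sY xi h hm.
  have := dlaguerre_markov p0 p1 uL sU u0 sY m; rewrite -/h -/xi /= => E.
  have xi0 : 0 < xi by rewrite sqrtr_gt0.
  have xi1 : xi < 1 by rewrite -sqrtr1 ltr_sqrt.
  have dh : (xi - xi^-1) * h m != 0.
    by rewrite mulf_neq0// subr_eq0 lt_eqF// (lt_trans xi1)// invf_gt1.
  apply: (mulIf dh); rewrite mulNr divfK// mulrA.
  by rewrite -[LHS]opprK -mulNr -E; congr (- _); ring.
Qed.
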